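(* Let $n$ be a positive integer and let $N$ and $M$ be ternary $\mathbb{Z}$-lattices such that $([N],[M])$ is a representable pair by scaling $n$. If $g(N)=g(M)$, then there is a genus-correspondence (for scaling $n$, between $\text{gen}(N)$ and $\text{gen}(M)$) that respects spinor genus.
   Context: All lattices are positive definite ternary $\mathbb{Z}$-lattices on positive definite quadratic spaces over $\mathbb{Q}$, with bilinear form $B$ and $Q(x)=B(x,x)$, which are non-classic integral, i.e. the norm ideal $\mathfrak{n}(L)$ (generated by the $Q(x)$, $x\in L$) is contained in $\mathbb{Z}$. For a nonzero rational $a$, $L^a$ is $L$ with its bilinear form scaled by $a$. $[L]$ denotes the isometry class of $L$; $\text{gen}(L)$ and $\text{spn}(L)$ are the genus and the (proper) spinor genus of $L$; $g(L)$ is the number of proper spinor genera in $\text{gen}(L)$. For a positive integer $n$, a pair $([N],[M])$ of isometry classes is a representable pair by scaling $n$ if there is a representation (isometry into) $\phi: M^n\to N$ with $[N:\phi(M^n)]=n$. A genus-correspondence is a subset $\mathfrak C\subseteq (\text{gen}(N)/\!\sim)\times(\text{gen}(M)/\!\sim)$ consisting of representable pairs by scaling $n$ such that for every $N'\in\text{gen}(N)$ there is $M'\in\text{gen}(M)$ with $([N'],[M'])\in\mathfrak C$, and for every $M'\in\text{gen}(M)$ there is $N'\in\text{gen}(N)$ with $([N'],[M'])\in\mathfrak C$. It respects spinor genus if for any $([N_1],[M_1]),([N_2],[M_2])\in\mathfrak C$: $N_1\in\text{spn}(N_2)$ if and only if $M_1\in\text{spn}(M_2)$. *)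

(* Defs.v *)
From HB Require Import structures.
From mathcomp Require Import all_boot all_order all_algebra.
From mathcomp Require Import boolp classical_sets functions cardinality.

Set Implicit Arguments.
Unset Strict Implicit.
Unset Printing Implicit Defensive.

Import Order.TTheory GRing.Theory Num.Theory.
Local Open Scope classical_set_scope.
Local Open Scope card_scope.
Local Open Scope ring_scope.

Definition primeNat := {p : nat | prime p}.

(** Z_p is the inverse limit of the Z/p^k: the residue modulo p^k is stored as
    its canonical representative in [0, p^k[. *)
Record padicInt (p : primeNat) := PadicInt {
  residue :> nat -> int;
  residueP : forall k, residue k = (residue k.+1 %% (val p)%:Z ^+ k)%Z }.

HB.instance Definition _ p := gen_eqMixin (padicInt p).
HB.instance Definition _ p := gen_choiceMixin (padicInt p).

Section PadicIntRing.
Variable p : primeNat.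
Notation q := ((val p)%:Z).
Implicit Types x y : padicInt p.

Let p_gt1 : (1 < val p)%N. Proof. exact: prime_gt1 (valP p). Qed.

Lemma padic_eq x y : (forall k, x k = y k) -> x = y.
Proof.
case: x y => [x hx] [y hy] /= /funext exy; subst y.
by congr PadicInt; exact: Prop_irrelevance.
Qed.

Lemma modz_expD (m : int) a b : ((m %% q ^+ (a + b))%Z = m %[mod q ^+ a])%Z.
Proof.
rewrite [in RHS](divz_eq m (q ^+ (a + b))).
set d := (m %/ _)%Z; set r := (m %% _)%Z.
by rewrite exprD [q ^+ a * _]mulrC mulrA modzMDl.
Qed.

Lemma residue_modS x k : (x k.+1 = x k %[mod q ^+ k])%Z.
Proof. by rewrite [in RHS]residueP modz_mod. Qed.

Lemma residue_mod x k : (x k %% q ^+ k)%Z = x k.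
Proof. by rewrite residueP modz_mod. Qed.

Fact of_coherent_subproof (f : nat -> int)
    (fP : forall k, (f k.+1 = f k %[mod q ^+ k])%Z) k :
  (f k %% q ^+ k)%Z = ((f k.+1 %% q ^+ k.+1)%Z %% q ^+ k)%Z.
Proof. by rewrite -addn1 modz_expD addn1 fP. Qed.

Definition of_coherent f fP : padicInt p :=
  @PadicInt p (fun k => (f k %% q ^+ k)%Z) (@of_coherent_subproof f fP).

Fact padic_int_subproof (m : int) k : (m = m %[mod q ^+ k])%Z.
Proof. by []. Qed.

Fact padic_opp_subproof x k : (- x k.+1 = - x k %[mod q ^+ k])%Z.
Proof. by rewrite -modzNm residue_modS modzNm. Qed.

Fact padic_add_subproof x y k :
  (x k.+1 + y k.+1 = x k + y k %[mod q ^+ k])%Z.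
Proof. by rewrite -modzDm !residue_modS modzDm. Qed.

Fact padic_mul_subproof x y k :
  (x k.+1 * y k.+1 = x k * y k %[mod q ^+ k])%Z.
Proof. by rewrite -modzMm !residue_modS modzMm. Qed.

Definition padic_int (m : int) := of_coherent (padic_int_subproof m).
Definition padic_opp x := of_coherent (padic_opp_subproof x).
Definition padic_add x y := of_coherent (padic_add_subproof x y).
Definition padic_mul x y := of_coherent (padic_mul_subproof x y).

Fact padic_addA : associative padic_add.
Proof. by move=> x y z; apply: padic_eq => k /=; rewrite modzDmr modzDml addrA. Qed.

Fact padic_addC : commutative padic_add.
Proof. by move=> x y; apply: padic_eq => k /=; rewrite addrC. Qed.

Fact padic_add0 : left_id (padic_int 0) padic_add.
Proof. by move=> x; apply: padic_eq => k /=; rewrite mod0z add0r residue_mod. Qed.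

Fact padic_addN : left_inverse (padic_int 0) padic_opp padic_add.
Proof. by move=> x; apply: padic_eq => k /=; rewrite modzDml addNr. Qed.

HB.instance Definition _ := GRing.isZmodule.Build (padicInt p)
  padic_addA padic_addC padic_add0 padic_addN.

Fact padic_mulA : associative padic_mul.
Proof. by move=> x y z; apply: padic_eq => k /=; rewrite modzMmr modzMml mulrA. Qed.

Fact padic_mulC : commutative padic_mul.
Proof. by move=> x y; apply: padic_eq => k /=; rewrite mulrC. Qed.

Fact padic_mul1 : left_id (padic_int 1) padic_mul.
Proof. by move=> x; apply: padic_eq => k /=; rewrite modzMml mul1r residue_mod. Qed.

Fact padic_mulDl : left_distributive padic_mul padic_add.
Proof. by move=> x y z; apply: padic_eq => k /=; rewrite modzMml modzDm mulrDl. Qed.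

Fact padic_1neq0 : padic_int 1 != padic_int 0.
Proof.
apply/eqP => /(congr1 (fun x : padicInt p => x 1%N)) /=.
by rewrite expr1 mod0z !modz_nat modn_small.
Qed.

HB.instance Definition _ := GRing.Zmodule_isComNzRing.Build (padicInt p)
  padic_mulA padic_mulC padic_mul1 padic_mulDl padic_1neq0.

Definition padic_unit : {pred padicInt p} := fun x => `[< exists y, y * x = 1 >].
Definition padic_inv x : padicInt p :=
  if pselect (exists y, y * x = 1) is left h then projT1 (cid h) else x.

Fact padic_mulV : {in padic_unit, left_inverse 1 padic_inv *%R}.
Proof.
move=> x /asboolP hx; rewrite /padic_inv.
by case: pselect => // h; case: (cid h).
Qed.

Fact padic_unitPl x y : y * x = 1 -> padic_unit x.
Proof. by move=> h; apply/asboolP; exists y. Qed.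

Fact padic_inv_out : {in [predC padic_unit], padic_inv =1 id}.
Proof.
move=> x /negP hx; rewrite /padic_inv; case: pselect => // h.
by case: hx; apply/asboolP.
Qed.

HB.instance Definition _ := GRing.ComNzRing_hasMulInverse.Build (padicInt p)
  padic_mulV padic_unitPl padic_inv_out.

Lemma residue_modD x a b : (x (a + b)%N %% q ^+ a)%Z = x a.
Proof.
elim: b => [|b IHb]; first by rewrite addn0 residue_mod.
by rewrite -[RHS]IHb addnS [x (a + b)%N]residueP modz_expD.
Qed.

Fact padic_mul_eq0 x y : x * y = 0 -> (x == 0) || (y == 0).
Proof.
move=> xy0; apply: contrapT => /negP; rewrite negb_or => /andP[x0 y0].
have nz (z : padicInt p) : z != 0 -> exists a, z a != 0.
  move=> /eqP z0; apply: contrapT => h; apply: z0; apply: padic_eq => k /=.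
  rewrite mod0z; apply: contrapT => zk; apply: h; exists k; exact/eqP.
have [[a xa] [b yb]] := (nz x x0, nz y y0).
have ndv (z : padicInt p) c d : z c != 0 -> ~~ (val p ^ c %| `|z (c + d)%N|)%N.
  apply: contra => h; rewrite -(residue_modD z c d).
  by apply/eqP/dvdz_mod0P; rewrite dvdzE abszX absz_nat.
have {}xa := ndv x a b xa.
have {}yb : ~~ (val p ^ b %| `|y (a + b)%N|)%N by rewrite addnC; exact: ndv.
have : (val p ^ (a + b) %| `|x (a + b)%N| * `|y (a + b)%N|)%N.
  have /(congr1 (fun z : padicInt p => z (a + b)%N)) /= := xy0.
  rewrite mod0z => /dvdz_mod0P; by rewrite dvdzE abszX abszM absz_nat.
have gt0 (z : int) c : ~~ (val p ^ c %| `|z|)%N -> (0 < `|z|)%N.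
  by rewrite lt0n; apply: contra => /eqP ->; exact: dvdn0.
have [xgt0 ygt0] := (gt0 _ _ xa, gt0 _ _ yb).
rewrite pfactor_dvdn ?muln_gt0 ?xgt0 ?(valP p) // lognM //.
move: xa yb; rewrite !pfactor_dvdn ?(valP p) // -!ltnNge => xa yb.
by rewrite leqNgt -addnS (leq_add (ltnW xa) yb).
Qed.

HB.instance Definition _ :=
  GRing.ComUnitRing_isIntegral.Build (padicInt p) padic_mul_eq0.

End PadicIntRing.

Definition padicNum (p : primeNat) := {fraction padicInt p}.

(** A ternary quadratic space over a field F is F^3 (row vectors) with the
    bilinear form of a symmetric Gram matrix; linear maps act on the right. *)
Section QuadraticSpace.
Variables (F : fieldType) (G : 'M[F]_3).

Definition bform (x y : 'rV[F]_3) : F := (x *m G *m y^T) 0 0.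
Definition qform x := bform x x.

Definition orthogonal_group : set 'M[F]_3 :=
  [set S | S \in unitmx /\ forall x y, bform (x *m S) (y *m S) = bform x y].

Definition special_orthogonal_group : set 'M[F]_3 :=
  [set S | orthogonal_group S /\ \det S = 1].

(** The symmetry x |-> x - (2 B(x, v) / Q(v)) v. *)
Definition symmetry_mx (v : 'rV[F]_3) : 'M[F]_3 :=
  1%:M - (2 / qform v) *: (G *m v^T *m v).

(** [spinor_norm S a] means that the spinor norm of S is the class of a modulo
    nonzero squares: S is a product of symmetries with respect to anisotropic
    vectors v_i, and a is the product of the Q(v_i) up to a square. *)
Definition spinor_norm (S : 'M[F]_3) (a : F) : Prop :=
  exists vs : seq 'rV[F]_3,
    [/\ forall v, v \in vs -> qform v != 0,
        S = \prod_(v <- vs) symmetry_mx v &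
        exists2 c : F, c != 0 & a = c ^+ 2 * \prod_(v <- vs) qform v].

Definition spinor_kernel : set 'M[F]_3 :=
  [set S | special_orthogonal_group S /\ spinor_norm S 1].

End QuadraticSpace.

Definition linear_image (F : fieldType) (S : 'M[F]_3) (A : set 'rV[F]_3) :
  set 'rV[F]_3 := [set x *m S | x in A].

Definition is_full_lattice (A : set 'rV[rat]_3) : Prop :=
  exists2 E : 'M[rat]_3, E \in unitmx &
    A = [set map_mx intr c *m E | c in [set: 'rV[int]_3]].

(** A full Z-lattice together with the quadratic space it lies on.  Positive
    definiteness is kept apart, so that every scaling is defined. *)
Record zlattice := ZLattice {
  gram : 'M[rat]_3;
  carrier : set 'rV[rat]_3;
  gram_sym : gram^T = gram;
  carrier_full : is_full_lattice carrier }.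

Definition positive_definite (L : zlattice) : Prop :=
  forall x : 'rV[rat]_3, x != 0 -> 0 < qform (gram L) x.

Definition norm_ideal (L : zlattice) : set rat :=
  [set a | exists k (c : 'I_k -> int) (x : 'I_k -> 'rV[rat]_3),
     (forall i, carrier L (x i)) /\
     a = \sum_i (c i)%:~R * qform (gram L) (x i)].

Definition nonclassic_integral (L : zlattice) : Prop :=
  norm_ideal L `<=` range (intr : int -> rat).

Fact scale_gram_sym (a : rat) (L : zlattice) : (a *: gram L)^T = a *: gram L.
Proof. by rewrite linearZ /= gram_sym. Qed.

Definition scale (a : rat) (L : zlattice) : zlattice :=
  ZLattice (scale_gram_sym a L) (carrier_full L).

Definition representation (L K : zlattice) (S : 'M[rat]_3) : Prop :=
  (forall x y, bform (gram K) (x *m S) (y *m S) = bform (gram L) x y) /\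
  linear_image S (carrier L) `<=` carrier K.

Definition isometric (L K : zlattice) : Prop :=
  exists2 S, representation L K S /\ S \in unitmx &
    linear_image S (carrier L) = carrier K.

Definition isometry_class (L : zlattice) : set zlattice :=
  [set K | isometric L K].

Definition cosets (A B : set 'rV[rat]_3) : set (set 'rV[rat]_3) :=
  [set [set x + y | y in B] | x in A].

(** [A : B] = n *)
Definition has_index (A B : set 'rV[rat]_3) (n : nat) : Prop :=
  cosets A B #= `I_n.

(** This depends only on the isometry classes of N and M. *)
Definition representable_pair (n : nat) (N M : zlattice) : Prop :=
  exists2 S, representation (scale n%:R M) N S &
    has_index (carrier N) (linear_image S (carrier M)) n.

Section Localization.
Variable p : primeNat.

Definition local_gram (L : zlattice) : 'M[padicNum p]_3 := map_mx ratr (gram L).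

(** L_p = Z_p L *)
Definition local_carrier (L : zlattice) : set 'rV[padicNum p]_3 :=
  [set x | exists k (a : 'I_k -> padicInt p) (v : 'I_k -> 'rV[rat]_3),
     (forall i, carrier L (v i)) /\
     x = \sum_i tofrac (a i) *: map_mx ratr (v i)].

End Localization.
Arguments local_gram p L : clear implicits.
Arguments local_carrier p L _ : clear implicits.

(** Genera and spinor genera consist of lattices on the same space. *)
Definition genus (L : zlattice) : set zlattice :=
  [set K | gram K = gram L /\
     forall p : primeNat, exists2 S, orthogonal_group (local_gram p L) S &
       local_carrier p K = linear_image S (local_carrier p L)].

Definition proper_spinor_genus (L : zlattice) : set zlattice :=
  [set K | gram K = gram L /\
     exists2 T, special_orthogonal_group (gram L) T &
       forall p : primeNat, exists2 S, spinor_kernel (local_gram p L) S &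
         local_carrier p K =
           linear_image (map_mx ratr T) (linear_image S (local_carrier p L))].

(** g(L) is the cardinality of this set; g(N) = g(M) is thus stated as
    [proper_spinor_genera N #= proper_spinor_genera M]. *)
Definition proper_spinor_genera (L : zlattice) : set (set zlattice) :=
  [set proper_spinor_genus K | K in genus L].

Definition genus_classes (L : zlattice) : set (set zlattice) :=
  [set isometry_class K | K in genus L].

Definition genus_correspondence (n : nat) (N M : zlattice)
    (C : set (set zlattice * set zlattice)) : Prop :=
  [/\ C `<=` genus_classes N `*` genus_classes M,
      forall N' M', C (isometry_class N', isometry_class M') ->
        representable_pair n N' M',
      forall N', genus N N' ->
        exists2 M', genus M M' & C (isometry_class N', isometry_class M') &
      forall M', genus M M' ->
        exists2 N', genus N N' & C (isometry_class N', isometry_class M')].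

(** Representatives are taken in gen(N) and gen(M), so that N1 and N2 (and M1
    and M2) lie on one space.  Since -1 has determinant -1, the choice of
    representatives in an isometry class does not matter. *)
Definition respects_spinor_genus (N M : zlattice)
    (C : set (set zlattice * set zlattice)) : Prop :=
  forall N1 N2 M1 M2, genus N N1 -> genus N N2 -> genus M M1 -> genus M M2 ->
    C (isometry_class N1, isometry_class M1) ->
    C (isometry_class N2, isometry_class M2) ->
    (proper_spinor_genus N2 N1 <-> proper_spinor_genus M2 M1).

(* Main.v *)
(** Write N_p, M_p for the localizations and view M inside the space V of N
    through the given representation S0.  Families s = (s_p) of local rotations
    of V for which a lattice N s with (N s)_p = N_p s_p exists form a group X, and
    the same s act on M through S0.  Since every local rotation is a product of
    symmetries, commutators have trivial spinor norm; hence the spinor genera in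
    gen(N) and in gen(M) correspond to the cosets of two subgroups H_N and H_M of X
    containing all commutators.  Each (N s, M s) is a representable pair,
    because the index is a determinant and local rotations preserve it up to units.
    The relation "aH_N meets bH_M" is a disjoint union of complete bipartite graphs
    K_(u,v) with u = [H_N H_M : H_N] and v = [H_N H_M : H_M]; as g(N) = g(M) is
    finite (reduction theory bounds the class number), u = v, so a perfect matching
    of spinor genera exists.  The correspondence consists of the representable
    pairs lying over matched spinor genera. *)
From HB Require Import structures.
Require Import Defs.
From mathcomp Require Import all_boot all_order all_algebra perm.
From mathcomp Require Import boolp classical_sets functions cardinality.
From mathcomp Require Import ring lra zify.

Set Implicit Arguments.
Unset Strict Implicit.
Unset Printing Implicit Defensive.

Import Order.TTheory GRing.Theory Num.Theory.
Local Open Scope classical_set_scope.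
Local Open Scope card_scope.
Local Open Scope ring_scope.

(** * p-adic numbers *)

(** That [s_p] fixes [N_p] for almost all [p] is never stated: the existence of [N s], tested on one
    lattice, stands for it, and a Chinese remainder argument carries existence over to every other
    lattice. The group law enters only through the operation [x y^-1 z], so [H_N] and [H_M] are
    never built; their cosets appear as the fibres of two labellings of families by spinor genera.
    Genera are defined by all local isometries; since [-1] is improper in dimension three and
    stabilises every lattice, rotations suffice. A family [s] in two matched cosets gives only one
    pair [(N s, M s)], whereas every lattice of each genus must occur in a pair. A lattice [N'] in
    the spinor genus of [N s] has the form [N s t], with [t] a spinor kernel family times a rational
    rotation. Conjugation by [S0] preserves both kinds of factor, so [M s t] remains in the spinor
    genus of [M s] and can be paired with [N']. The inverse similitude does the same for a lattice
    of gen(M). *)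

Section PadicNumbers.
Variable p : primeNat.
Local Notation q := ((val p)%:Z).

Lemma intr_padicE (m : int) : m%:~R = padic_int p m.
Proof.
have natE n : n%:R = padic_int p n%:Z.
  elim: n => [//|n IHn]; rewrite -natr1 IHn; apply: padic_eq => k /=.
  by rewrite modzDm -PoszD addn1.
case: m => n; first exact: natE.
rewrite NegzE mulrNz -[_ *~ _]/(n.+1%:R) natE; apply: padic_eq => k /=.
by rewrite modzNm.
Qed.

Lemma intr_padic_inj (m : int) : (m%:~R == 0 :> padicInt p) = (m == 0).
Proof.
apply/eqP/eqP => [|-> //]; rewrite intr_padicE => m0; apply/eqP.
(* Level [|m|] is enough: [p ^ |m| > |m|], so divisibility of [m] by this power forces [m = 0]. *)
have := congr1 (fun z : padicInt p => z `|m|%N) m0.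
rewrite /= mod0z => /dvdz_mod0P; rewrite dvdzE abszX absz_nat.
rewrite -absz_eq0; apply: contraTT; rewrite -lt0n => m_gt0.
apply: contraL (ltn_expl `|m| (prime_gt1 (valP p))) => dv.
by rewrite -leqNgt (dvdn_leq m_gt0 dv).
Qed.

Lemma intr_padicNum_inj (m : int) : (m%:~R == 0 :> padicNum p) = (m == 0).
Proof. by rewrite -(rmorph_int (@tofrac _)) tofrac_eq0 intr_padic_inj. Qed.

(** [ratr] carries a morphism structure only for ordered target fields. *)
Definition qp (r : rat) : padicNum p := ratr r.

Let nz_den x : (denq x)%:~R != 0 :> padicNum p.
Proof. by rewrite intr_padicNum_inj denq_eq0. Qed.

(** Clearing denominators reduces the claim to an identity of integers; what makes this possible is
    that nonzero integers stay nonzero in the p-adic numbers. *)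
Fact qp_zmod_morphism : zmod_morphism qp.
Proof.
have injZtoQ: @injective rat int intr by apply: intr_inj.
move=> x y; rewrite /qp /ratr.
apply: (canLR (mulfK (nz_den _))); apply: (mulIf (nz_den x)).
rewrite mulrAC mulrBl divfK // mulrAC -!rmorphM.
apply: (mulIf (nz_den y)); rewrite mulrAC mulrBl divfK //.
rewrite -!(rmorphM, rmorphB); congr _%:~R; apply: injZtoQ.
rewrite !(rmorphM, rmorphB) /= [_ - _]lock /= -lock !numqE.
by rewrite (mulrAC y) -!mulrBl -mulrA mulrAC !mulrA.
Qed.

Fact qp_monoid_morphism : monoid_morphism qp.
Proof.
have injZtoQ: @injective rat int intr by apply: intr_inj.
split=> [|x y]; first by rewrite /qp /ratr divr1.
rewrite /qp /ratr mulrC mulrAC; apply: canLR (mulKf (nz_den _)) _.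
rewrite !mulrA; do 2!apply: canRL (mulfK (nz_den _)) _.
rewrite -!rmorphM; congr _%:~R; apply: injZtoQ.
rewrite !rmorphM [x * y]lock /= !numqE -lock.
by rewrite -!mulrA mulrA mulrCA -!mulrA (mulrCA y).
Qed.

HB.instance Definition _ := GRing.isZmodMorphism.Build rat (padicNum p) qp
  qp_zmod_morphism.
HB.instance Definition _ := GRing.isMonoidMorphism.Build rat (padicNum p) qp
  qp_monoid_morphism.

(** A shift of digits: [m] is the residue modulo [p^k], and [w] collects the quotients
    [(z (k + j) - z k) / p^k], which are coherent in [j]. *)
Lemma padic_approx (z : padicInt p) k :
  exists (m : int) (w : padicInt p), z = m%:~R + q%:~R ^+ k * w.
Proof.
have q0 : q ^+ k != 0 by rewrite expf_neq0 // -lt0n prime_gt0 ?(valP p).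
have dv j : (q ^+ k %| z (k + j)%N - z k)%Z.
  by rewrite -eqz_mod_dvd residue_modD residue_mod.
pose f j := ((z (k + j)%N - z k) %/ q ^+ k)%Z.
have fE j : z (k + j)%N = z k + q ^+ k * f j.
  by rewrite mulrC divzK // addrC subrK.
have fP j : (f j.+1 = f j %[mod q ^+ j])%Z.
  apply/eqP; rewrite eqz_mod_dvd -(@dvdz_mul2l (q ^+ k) (q ^+ j) _ q0) //.
  rewrite -exprD mulrBr; have -> : q ^+ k * f j.+1 - q ^+ k * f j =
    z (k + j).+1 - z (k + j)%N by rewrite -addnS !fE; ring.
  by rewrite -eqz_mod_dvd residue_modS.
exists (z k), (of_coherent fP).
have <- : (q ^+ k)%:~R = q%:~R ^+ k :> padicInt p by rewrite rmorphXn.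
rewrite !intr_padicE.
apply: padic_eq => j /=; rewrite modzMm modzDm.
by rewrite -fE addnC residue_modD.
Qed.

(** Bezout gives an inverse of [m] modulo each [p^k]; uniqueness of inverses makes these coherent,
    so they glue to a p-adic inverse. *)
Lemma intr_padic_unit (m : int) : coprimez m q ->
  (m%:~R : padicInt p) \is a GRing.unit.
Proof.
move=> co_mq; pose f k := (egcdz m (q ^+ k)).1.
have fE k : (f k * m = 1 %[mod q ^+ k])%Z.
  rewrite /f; case: egcdzP => u v /= uv _.
  have /eqP g1 : coprimez m (q ^+ k) by exact: coprimezXr.
  by rewrite -g1 -uv addrC modzMDl.
have fP k : (f k.+1 = f k %[mod q ^+ k])%Z.
  have fS : (f k.+1 * m = 1 %[mod q ^+ k])%Z.
    have := congr1 (fun x => (x %% q ^+ k)%Z) (fE k.+1).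
    by rewrite -addn1 !modz_expD.
  rewrite -[in LHS](mulr1 (f _)) -modzMmr -(fE k) modzMmr mulrCA -modzMmr.
  by rewrite fS modzMmr mulr1.
have fm1 : of_coherent fP * m%:~R = 1.
  by rewrite intr_padicE; apply: padic_eq => k /=; rewrite modzMmr modzMml fE.
by apply/unitrP; exists (of_coherent fP); rewrite [m%:~R * _]mulrC.
Qed.

Definition integral (x : padicNum p) : Prop := exists z, x = tofrac z.

End PadicNumbers.

(** A prime [P] dividing the denominator would also divide the numerator: read
    [z * denominator = numerator] modulo [P]. *)
Lemma rat_integral (r : rat) :
  (forall p, integral (qp p r)) -> exists m : int, r = m%:~R.
Proof.
move=> r_int; exists (numq r); rewrite -[LHS]divq_num_den.
suff -> : denq r = 1 by rewrite divr1.
apply/eqP; rewrite -absz_denq eqz_nat; apply: contrapT => /negP d1.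
have d_gt1 : (1 < `|denq r|)%N.
  by rewrite ltn_neqAle eq_sym d1 absz_gt0 denq_neq0.
pose P : primeNat := exist _ (pdiv `|denq r|) (pdiv_prime d_gt1).
have [z rz] := r_int P.
have /eqP : tofrac (z * (denq r)%:~R) = (numq r)%:~R :> padicNum P.
  rewrite rmorphM /= -rz rmorph_int -[(denq r)%:~R](rmorph_int (qp P)).
  by rewrite -rmorphM /= -numqE rmorph_int.
rewrite -(rmorph_int (@tofrac (padicInt P))) tofrac_eq => /eqP.
rewrite !intr_padicE => /(congr1 (fun z : padicInt P => z 1%N)) /=.
have P_den : ((pdiv `|denq r|)%:Z %| denq r)%Z by rewrite dvdzE pdiv_dvd.
rewrite expr1 modzMmr => /eqP; rewrite eqz_mod_dvd => h.
have {h} P_num : ((pdiv `|denq r|)%:Z %| numq r)%Z.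
  rewrite -[numq r](subKr (z 1%N * denq r)) rpredB // ?dvdz_mull //.
have := coprime_num_den r; rewrite /coprime => /eqP g1.
have : (pdiv `|denq r| %| gcdn `|numq r| `|denq r|)%N.
  by rewrite dvdn_gcd -!(dvdzE (pdiv _)%:Z) P_num.
by rewrite g1 dvdn1 => /eqP P1; have := pdiv_prime d_gt1; rewrite P1.
Qed.

(** * Bases of lattices *)

Section LatticeBases.
Variables (R : comUnitRingType) (F : fieldType) (f : {rmorphism R -> F}).
Hypothesis f_inj : injective f.
Variable n : nat.
Implicit Types E : 'M[F]_n.

(** Serves both for Z-lattices over the rationals and for their completions over the p-adic
    integers; the rows of [E] generate. *)
Definition lat E : set 'rV[F]_n := [set map_mx f c *m E | c in [set: 'rV[R]_n]].

Lemma lat_row E i : lat E (row i E).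
Proof. by exists (delta_mx 0 i) => //; rewrite map_delta_mx -rowE. Qed.

Lemma lat_rows E E' : (forall i, lat E' (row i E)) ->
  exists U, E = map_mx f U *m E'.
Proof.
move=> rowE'.
have /choice[c cE] : forall i, exists d, map_mx f d *m E' = row i E.
  by move=> i; have [c _ <-] := rowE' i; exists c.
exists (\matrix_i c i); apply/row_matrixP => i.
rewrite -cE row_mul; congr (_ *m _); apply/rowP => j; by rewrite !mxE.
Qed.

Lemma lat_sub E E' : lat E `<=` lat E' <-> exists U, E = map_mx f U *m E'.
Proof.
split=> [sub|[U ->] _ [c _ <-]].
  by apply: lat_rows => i; exact/sub/lat_row.
by exists (c *m U) => //; rewrite map_mxM mulmxA.
Qed.

Lemma latD E x y : lat E x -> lat E y -> lat E (x + y).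
Proof.
by move=> [c _ <-] [d _ <-]; exists (c + d); rewrite // map_mxD mulmxDl.
Qed.

Lemma latZ E a x : lat E x -> lat E (f a *: x).
Proof.
by move=> [c _ <-]; exists (a *: c); rewrite // map_mxZ -scalemxAl.
Qed.

Lemma latB E x y : lat E x -> lat E y -> lat E (x - y).
Proof.
move=> Ex Ey; apply: latD => //; rewrite -scaleN1r -(rmorph1 f) -rmorphN.
exact: latZ.
Qed.

Lemma map_mx_unit (U : 'M[R]_n) : U \in unitmx -> map_mx f U \in unitmx.
Proof. by rewrite !unitmxE det_map_mx => /(rmorph_unit f). Qed.

Lemma lat_eqP E E' : E \in unitmx ->
  lat E = lat E' <-> exists2 U, U \in unitmx & E = map_mx f U *m E'.
Proof.
move=> uE; split=> [eqE|[U uU EU]].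
  have [U EU] : exists U, E = map_mx f U *m E'.
    by apply/lat_sub; rewrite eqE.
  have [V EV] : exists V, E' = map_mx f V *m E.
    by apply/lat_sub; rewrite eqE.
  exists U => //; suff UV : U *m V = 1%:M by case/mulmx1_unit: UV.
  have : map_mx f (U *m V) = map_mx f 1%:M.
    by rewrite map_mxM map_mx1 -[LHS](mulmxK uE) -2!mulmxA (mulmxA _ E) -EV
               mulmxA -EU mulmxV.
  by move/matrixP => UV; apply/matrixP => i j; apply: f_inj; have := UV i j;
     rewrite !mxE.
apply/seteqP; split; apply/lat_sub; first by exists U.
exists (invmx U); rewrite EU mulmxA -map_mxM mulVmx // map_mx1 mul1mx //.
Qed.

End LatticeBases.

Lemma linear_imageM (F : fieldType) (A : set 'rV[F]_3) (S T : 'M[F]_3) :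
  linear_image T (linear_image S A) = linear_image (S *m T) A.
Proof.
apply/seteqP; split=> [_ [_ [x Ax <-] <-]|_ [x Ax <-]].
  by exists x => //; rewrite mulmxA.
by exists (x *m S); rewrite ?mulmxA //; exists x.
Qed.

Lemma linear_image1 (F : fieldType) (A : set 'rV[F]_3) : linear_image 1%:M A = A.
Proof.
apply/seteqP; split=> [_ [x Ax <-]|x Ax]; rewrite ?mulmx1 //.
by exists x => //; rewrite mulmx1.
Qed.

Lemma linear_image_lat (R : comUnitRingType) (F : fieldType)
    (f : {rmorphism R -> F}) (E S : 'M[F]_3) :
  linear_image S (lat f E) = lat f (E *m S).
Proof.
apply/seteqP; split=> [_ [_ [c _ <-] <-]|_ [c _ <-]].
  by exists c => //; rewrite mulmxA.
by exists (map_mx f c *m E); rewrite ?mulmxA //; exists c.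
Qed.

Notation zlat := (lat (intr : int -> rat)).
Notation plat p := (lat (@tofrac (padicInt p))).

Lemma tofrac_inj (p : primeNat) : injective (@tofrac (padicInt p)).
Proof. by move=> x y /eqP; rewrite tofrac_eq => /eqP. Qed.

Lemma zlattice_basis (L : zlattice) :
  exists2 E : 'M[rat]_3, E \in unitmx & carrier L = zlat E.
Proof. exact: carrier_full. Qed.

Lemma map_intr_qp (p : primeNat) m n (c : 'M[int]_(m, n)) :
  map_mx (qp p) (map_mx intr c) = map_mx (@tofrac _) (map_mx intr c).
Proof. by apply/matrixP => i j; rewrite !mxE !rmorph_int. Qed.

(** Replaces the span of arbitrary finite combinations by a free module on a basis, so that
    localizations are handled by matrices. *)
Lemma local_carrierE (p : primeNat) (L : zlattice) (E : 'M[rat]_3) :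
  carrier L = zlat E -> local_carrier p L = plat p (map_mx (qp p) E).
Proof.
move=> LE; apply/seteqP; split=> x.
  case=> k [a [v [Lv ->]]].
  have /choice[c cE] : forall i, exists d, map_mx intr d *m E = v i.
    move=> i.
    by have := Lv i; rewrite LE => -[d _ <-]; exists d.
  exists (\sum_i a i *: map_mx intr (c i)) => //.
  rewrite raddf_sum mulmx_suml; apply: eq_bigr => i _.
  rewrite /= map_mxZ -scalemxAl -[map_mx ratr (v i)]/(map_mx (qp p) (v i)) -cE.
  by rewrite (map_mxM (qp p)) map_intr_qp.
case=> c _ <-; exists 3%N, (fun i => c 0 i), (fun i => row i E); split.
  by move=> i; rewrite LE; exact: lat_row.
rewrite mulmx_sum_row; apply: eq_bigr => i _.
by rewrite !mxE -map_row.
Qed.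

Lemma zlat_local (E : 'M[rat]_3) (x : 'rV[rat]_3) : E \in unitmx ->
  (forall p, plat p (map_mx (qp p) E) (map_mx (qp p) x)) -> zlat E x.
Proof.
move=> uE loc; have y_int i : exists m : int, (x *m invmx E) 0 i = m%:~R.
  apply: rat_integral => p; have [c _ cE] := loc p; exists (c 0 i).
  suff : map_mx (qp p) (x *m invmx E) = map_mx (@tofrac _) c.
    by move/matrixP => /(_ 0 i); rewrite !mxE.
  by rewrite map_mxM -cE -mulmxA -map_mxM mulmxV // map_mx1 mulmx1.
have [c cE] := choice y_int; exists (\row_i c i) => //.
rewrite -[RHS](mulmxKV uE); congr (_ *m _); apply/rowP => i.
by rewrite cE !mxE.
Qed.

(** * Lattices with prescribed localizations *)

(** Hermite form by induction on [n]: one vector [w] generates the ideal of first coordinates, and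
    the elements with first coordinate 0 form a subgroup in one dimension less. [H] may be singular,
    since [X] may have smaller rank. *)
Lemma subgroup_basis n (X : set 'rV[int]_n) :
  X 0 -> (forall x y, X x -> X y -> X (x - y)) ->
  exists H : 'M[int]_n, forall x, X x <-> exists c, x = c *m H.
Proof.
elim: n X => [|n IHn] X X0 XB.
  by exists 0 => x; split=> _; [exists 0|]; rewrite ?thinmx0 // [x]thinmx0.
have XZ k x : X x -> X (k *: x).
  have XN y : X y -> X (- y) by move=> Xy; rewrite -sub0r; exact: XB.
  have Xn m y : X y -> X (m%:Z *: y).
    move=> Xy; elim: m => [|m IHm]; first by rewrite scale0r.
    have -> : Posz m.+1 = m%:Z + 1 by lia.
    by rewrite scalerDl scale1r -[X in _ + X]opprK; exact/XB/XN.
  by case: k => m Xx; rewrite ?NegzE ?scaleNr; [exact: Xn|exact/XN/Xn].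
have [w Xw w_div] : exists2 w, X w &
    forall x, X x -> exists q, x 0 0 = q * w 0 0.
  (* Either some first coordinate is positive, and [w] realises the least one, or all of them vanish
     and [w = 0] will do. *)
  have [[k [x [Xx xk]]]|no_pos] := pselect
    (exists (k : nat) x, X x /\ (x : 'rV[int]_n.+1) 0 0 = k.+1%:Z); last first.
    exists 0 => // x Xx; exists 0; rewrite mul0r; apply: contrapT => /eqP x0.
    apply: no_pos; have [x_ge0|x_le0] := lerP 0 (x 0 0).
      exists (absz (x 0 0)).-1, x; split=> //.
      by move: (x 0 0) x0 x_ge0 => t; lia.
    exists (absz (x 0 0)).-1, (- x); rewrite mxE -[- x]sub0r.
    split; first exact: XB.
    by move: (x 0 0) x0 x_le0 => t; lia.
  have exP : exists k, `[< exists2 x, X x & x 0 0 = k.+1%:Z >].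
    by exists k; apply/asboolP; exists x.
  case: (ex_minnP exP) => m /asboolP[w Xw wm] m_min; exists w => // y Xy.
  have [t ty] : exists t : int, t = y 0 0 by eexists.
  exists (t %/ m.+1%:Z)%Z; rewrite -ty wm [LHS](divz_eq t m.+1%:Z).
  apply/eqP; rewrite -subr_eq0 addrC addKr; apply: contrapT => /eqP y_mod.
  have y_lt : (t %% m.+1%:Z)%Z < m.+1%:Z by rewrite ltz_pmod.
  have y_ge : 0 <= (t %% m.+1%:Z)%Z by rewrite modz_ge0.
  have : (m <= (absz (t %% m.+1%:Z)%Z).-1)%N.
    apply: m_min; apply/asboolP.
    exists (y - (t %/ m.+1%:Z)%Z *: w); first exact/XB/XZ.
    rewrite !mxE wm -ty; have := divz_eq t m.+1%:Z.
    by move: (t %/ _)%Z (t %% _)%Z y_lt y_ge y_mod => ? ?; lia.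
  by move: (t %% _)%Z y_lt y_ge y_mod => ?; lia.
have [] := IHn [set y | X (row_mx (0 : 'rV_1) y : 'rV_(1 + n))].
- by rewrite /= row_mx0.
- by move=> x y Xx Xy /=; rewrite -[0]subr0 -add_row_mx -opp_row_mx; exact: XB.
move=> H HP; exists (col_mx (w : 'rV_(1 + n)) (row_mx 0 H) : 'M_(1 + n)) => x.
split=> [Xx|[c ->]].
  have [q qP] := w_div x Xx.
  pose y : 'rV_(1 + n) := x - q *: w.
  have yl : lsubmx y = 0.
    apply/rowP => i; rewrite ord1 mxE.
    have -> : lshift n (0 : 'I_1) = (0 : 'I_n.+1) by apply: val_inj.
    by rewrite !mxE qP subrr.
  have [d dP] : exists d, rsubmx y = d *m H.
    by apply/HP; rewrite /= -yl hsubmxK; exact/XB/XZ.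
  exists (row_mx q%:M d : 'rV_(1 + n)).
  apply: eq_trans; last
    exact: esym (@mul_row_col _ 1 1 n (1 + n) q%:M d w (row_mx 0 H)).
  rewrite mul_mx_row mulmx0 -dP mul_scalar_mx -{1}yl hsubmxK.
  by rewrite addrC subrK.
have -> : c *m (col_mx (w : 'rV_(1 + n)) (row_mx 0 H) : 'M_(1 + n)) =
    lsubmx (c : 'rV_(1 + n)) *m w +
    rsubmx (c : 'rV_(1 + n)) *m (row_mx 0 H : 'M_(n, 1 + n)).
  by rewrite -[c in LHS](@hsubmxK _ 1 1 n); exact: (@mul_row_col _ 1 1 n (1 + n)).
rewrite -[X in X + _]opprK addrC.
apply: XB; first by rewrite mul_mx_row mulmx0; apply/HP; eexists.
by rewrite [lsubmx _]mx11_scalar mul_scalar_mx -scaleNr; exact: XZ.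
Qed.

Lemma common_denominator m n (A : 'M[rat]_(m, n)) :
  exists2 d : nat, (0 < d)%N & exists B, d%:R *: A = map_mx intr B.
Proof.
pose d := (\prod_i \prod_j `|denq (A i j)|)%N.
exists d.
  by rewrite prodn_gt0 // => i; rewrite prodn_gt0 // => j; rewrite absz_gt0 denq_neq0.
have dA i j : exists b : int, d%:R * A i j = b%:~R.
  exists ((\prod_(k | k != i) \prod_j `|denq (A k j)|)%N%:Z *
    (\prod_(k | k != j) `|denq (A i k)|)%N%:Z * numq (A i j)).
  rewrite /d (bigD1 i) //= (bigD1 j) //= -{1}(absz_denq (A i j)) !natrM !intrM.
  rewrite numqE -(absz_denq (A i j)) -!pmulrn; ring.
have /choice[b bP] : forall ij : 'I_m * 'I_n, exists b : int, d%:R * A ij.1 ij.2 = b%:~R.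
  by move=> [i j]; exact: dA.
exists (\matrix_(i, j) b (i, j)); apply/matrixP => i j; rewrite !mxE.
exact: (bP (i, j)).
Qed.

Lemma coprime_primeNat (p q : primeNat) k : p != q ->
  coprimez (val p ^ k)%:Z (val q)%:Z.
Proof.
move=> pq; rewrite /coprimez /gcdz !absz_nat eqz_nat -/(coprime _ _).
apply: coprimeXl; rewrite prime_coprime ?(valP p) //.
by rewrite dvdn_prime2 ?(valP p) ?(valP q).
Qed.

Lemma plat_scale (p : primeNat) (d : nat) (A : 'M[int]_3) (E F : 'M[rat]_3)
    (S : 'M[padicNum p]_3) x :
  d%:R *: F = map_mx intr A *m E ->
  plat p (map_mx (qp p) F *m S) x -> plat p (map_mx (qp p) E *m S) (d%:R *: x).
Proof.
move=> dF [c _ <-]; exists (c *m map_mx intr A) => //.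
rewrite (map_mxM (@tofrac _)) -map_intr_qp -mulmxA [map_mx (qp p) _ *m (_ *m _)]mulmxA.
rewrite -(map_mxM (qp p)) -dF map_mxZ rmorph_nat -scalemxAl -scalemxAr //.
Qed.

Lemma padic_approx_row (p : primeNat) n (z : 'rV[padicInt p]_n) k :
  exists (a : 'rV[int]_n) (w : 'rV[padicInt p]_n),
    z = map_mx intr a + (val p ^ k)%:R *: w.
Proof.
have /choice[aw awP] : forall i, exists aw : int * padicInt p,
    z 0 i = aw.1%:~R + (val p ^ k)%:R * aw.2.
  move=> i; have [a [w ->]] := padic_approx (z 0 i) k.
  by exists (a, w); rewrite natrX.
exists (\row_i (aw i).1), (\row_i (aw i).2); apply/rowP => i.
by rewrite !mxE awP.
Qed.

(** [F'] is the intersection over all [p] of the local lattices [F_p S_p]. Since [E] and [F] are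
    commensurable through [d], each [F_p S_p] lies between [d E'_p] and [d^-1 E'_p]; this makes the
    intersection a full lattice with the right localizations. *)
Lemma lattice_transport (E F E' : 'M[rat]_3) (S : forall p, 'M[padicNum p]_3) :
  E \in unitmx -> F \in unitmx -> E' \in unitmx ->
  (forall p, plat p (map_mx (qp p) E') = plat p (map_mx (qp p) E *m S p)) ->
  exists2 F' : 'M[rat]_3, F' \in unitmx &
    forall p, plat p (map_mx (qp p) F') = plat p (map_mx (qp p) F *m S p).
Proof.
move=> uE uF uE' E'S.
have [d [d_gt0 [A dF] [B dE]]] : exists d : nat, [/\ (0 < d)%N,
    exists A, d%:R *: F = map_mx intr A *m E &
    exists B, d%:R *: E = map_mx intr B *m F].
  have [d d_gt0 [A dA]] := common_denominator (F *m invmx E).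
  have [e e_gt0 [B eB]] := common_denominator (E *m invmx F).
  exists (d * e)%N; split; first by rewrite muln_gt0 d_gt0.
    exists (e%:R *: A); rewrite map_mxZ rmorph_nat -dA scalerA -natrM mulnC.
    by rewrite -scalemxAl mulmxKV.
  exists (d%:R *: B); rewrite map_mxZ rmorph_nat -eB scalerA -natrM.
  by rewrite -scalemxAl mulmxKV.
have FE' p x : plat p (map_mx (qp p) F *m S p) x ->
    plat p (map_mx (qp p) E') (d%:R *: x).
  by rewrite E'S; exact: plat_scale dF.
have E'F p x : plat p (map_mx (qp p) E') x ->
    plat p (map_mx (qp p) F *m S p) (d%:R *: x).
  by rewrite E'S; exact: plat_scale dE.
have d0 : d%:R != 0 :> rat by rewrite pnatr_eq0 -lt0n.
have dp0 p : d%:R != 0 :> padicNum p.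
  by rewrite -(rmorph_nat (qp p)) fmorph_eq0.
(* Coordinates with respect to [d^-1 E'] of the global vectors that lie in [F_p S_p] for every [p];
   by [FE'] no such vector is missed. *)
pose X : set 'rV[int]_3 := [set c | forall p, plat p (map_mx (qp p) F *m S p)
  (d%:R^-1 *: (map_mx (@tofrac _) (map_mx intr c) *m map_mx (qp p) E'))].
have [||H XP] := @subgroup_basis 3 X.
- by move=> p; rewrite !map_mx0 mul0mx scaler0; exists 0; rewrite // map_mx0 mul0mx.
- move=> x y Xx Xy p; rewrite !map_mxB mulmxBl scalerBr.
  exact: latB (Xx p) (Xy p).
have dX c : X ((d ^ 2)%:R *: c).
  move=> p; rewrite map_mxZ map_mxZ !rmorph_nat -scalemxAl scalerA.
  rewrite natrX expr2 mulKf ?dp0 //; apply: E'F; by exists (map_mx intr c).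
(* The intersection contains [d E'], whose coordinates are the multiples of [d ^ 2]; hence [H] is
   invertible over the rationals. *)
have [C CH] : exists C, (d ^ 2)%:R%:M = C *m H.
  have /choice[c cP] : forall i, exists c, row i (d ^ 2)%:R%:M = c *m H.
    move=> i; apply/XP; rewrite -scalemx1 linearZ /=; exact: dX.
  exists (\matrix_i c i); apply/row_matrixP => i.
  by rewrite cP row_mul rowK.
pose F' : 'M[rat]_3 := d%:R^-1 *: (map_mx intr H *m E').
have CF' : map_mx intr C *m F' = d%:R *: E'.
  rewrite /F' -scalemxAr mulmxA -(map_mxM intr) -CH map_scalar_mx mul_scalar_mx.
  by rewrite rmorph_nat scalerA natrX expr2 mulKf.
have uF' : F' \in unitmx.
  suff : (d%:R^-1 *: map_mx intr C) *m (F' *m invmx E') = 1%:M.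
    by case/mulmx1_unit => _; rewrite unitmx_mul => /andP[].
  rewrite mulmxA -scalemxAl CF' -!scalemxAl mulmxV // scalerA mulVf //.
  by rewrite scale1r.
have F'E p c : d%:R^-1 *: (map_mx (@tofrac _) (map_mx intr (c *m H)) *m
    map_mx (qp p) E') = map_mx (@tofrac _) (map_mx intr c) *m map_mx (qp p) F'.
  rewrite /F' map_mxZ fmorphV rmorph_nat -scalemxAr (map_mxM intr) (map_mxM (@tofrac _)).
  by rewrite (map_mxM (qp p)) map_intr_qp mulmxA.
exists F' => // p; apply/seteqP; split.
  apply/lat_sub/lat_rows => i.
  have /(_ p) : X (row i H) by apply/XP; exists (delta_mx 0 i); rewrite -rowE.
  by rewrite [row i H]rowE F'E -map_intr_qp map_delta_mx map_delta_mx -rowE.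
move=> y Fy; have [z _ zE] := FE' p y Fy.
have d2_gt0 : (0 < d ^ 2)%N by rewrite expn_gt0 d_gt0.
(* Write [d ^ 2 = m p^k] with [m] prime to [p]. A local vector [y] at [p] is to be approximated by a
   global one that causes no trouble at the other primes. *)
have [m co_m] := pfactor_coprime (valP p) d2_gt0; set k := logn _ _ => dm.
have [a [w zaw]] := padic_approx_row z k.
have co_mp : coprimez m%:Z (val p)%:Z.
  by rewrite /coprimez /gcdz !absz_nat eqz_nat -/(coprime _ _) coprime_sym.
have co_mk : coprimez m%:Z (val p ^ k)%:Z.
  move: co_mp; rewrite /coprimez /gcdz !absz_nat !eqz_nat -!/(coprime _ _).
  exact: coprimeXr.
have [u [v]] := Bezoutz m%:Z (val p ^ k)%:Z; rewrite (eqP co_mk) => uv.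
(* Chinese remainder: [x] is congruent to [z] modulo [p^k] and divisible by [m]. *)
pose x := (u * m%:Z) *: a; pose z' := v%:~R *: map_mx intr a + w.
have zx : z = map_mx intr x + (val p ^ k)%:R *: z'.
  rewrite {1}zaw scalerDr addrA; congr (_ + _).
  apply/rowP => i; rewrite !mxE.
  transitivity (((u * m%:Z + v * (val p ^ k)%:Z) * a 0 i)%:~R : padicInt p).
    by rewrite uv mul1r.
  rewrite !(intrM, intrD) -!pmulrn; ring.
(* If [d ^ 2 = b c] with [c] a unit at [q], then [d^-1 b = d c^-1] is a q-adic multiple of [d], and
   [d E'_q] lies in [F_q S_q]. *)
have cancel_scalar (q : primeNat) (b c : nat) : (d ^ 2)%N = (b * c)%N ->
    coprimez c%:Z (val q)%:Z ->
    (d%:R^-1 * b%:R : padicNum q) = d%:R * tofrac (c%:R^-1).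
  move=> bc co_c; have := intr_padic_unit co_c; rewrite -pmulrn => uc.
  apply: (mulfI (dp0 q)); rewrite mulrA mulfV ?dp0 // mul1r mulrA -expr2 -natrX bc.
  rewrite natrM -mulrA -(rmorph_nat (@tofrac (padicInt q)) c).
  by rewrite -rmorphM /= mulrV // rmorph1 mulr1.
pose t := d%:R *: (map_mx (@tofrac _) (m%:R^-1 *: z') *m map_mx (qp p) E').
have yx : y = d%:R^-1 *: (map_mx (@tofrac _) (map_mx intr x) *m
    map_mx (qp p) E') + t.
  rewrite -[LHS](scalerK (dp0 p)) -zE zx map_mxD mulmxDl scalerDr.
  congr (_ + _); rewrite /t !map_mxZ -!scalemxAl !scalerA rmorph_nat.
  by rewrite (@cancel_scalar p _ m) // mulnC.
(* At [p], the vector differs from [y] by [t], which is in [d E'_p]; at [q] different from [p],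
   divisibility of [x] by [m] puts it in [d E'_q]. *)
have Xx : X x.
  move=> q; have [->|neq_qp] := eqVneq q p.
    rewrite -[X in plat p _ X](addrK t) -yx; apply: latB => //.
    by apply: E'F; exists (m%:R^-1 *: z').
  rewrite /x mulrC -scalerA !map_mxZ !rmorph_int -scalemxAl scalerA.
  rewrite -pmulrn (@cancel_scalar q m (val p ^ k)%N) //; last first.
    by apply: coprime_primeNat; rewrite eq_sym.
  rewrite -scalerA; apply: E'F; apply: latZ.
  by exists (map_mx intr (u *: a)); rewrite // !map_mxZ !rmorph_int.
have [c xc] := (XP x).1 Xx.
rewrite yx xc F'E; apply: latD; first by exists (map_mx intr c).
rewrite /t scalemxAr -(rmorph_nat (qp p)) -map_mxZ -CF' (map_mxM (qp p)).
rewrite mulmxA map_intr_qp -(map_mxM (@tofrac _)).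
by eexists.
Qed.

(** * Symmetries and the spinor kernel *)

Section Symmetries.
Variables (F : fieldType) (G : 'M[F]_3).
Hypothesis G_sym : G^T = G.
Hypothesis two_neq0 : 2 != 0 :> F.
Implicit Types (x y v : 'rV[F]_3) (S T : 'M[F]_3) (vs : seq 'rV[F]_3).
Local Notation B := (bform G).
Local Notation Q := (qform G).
Local Notation sym := (symmetry_mx G).

Lemma bformC x y : B x y = B y x.
Proof.
rewrite /bform -[in RHS]mulmxA -[LHS]trace_mx11 -[RHS]trace_mx11 -mxtrace_tr.
by rewrite !trmx_mul trmxK G_sym.
Qed.

Lemma bformDl x y z : B (x + y) z = B x z + B y z.
Proof. by rewrite /bform !mulmxDl mxE. Qed.

Lemma bformZl a x y : B (a *: x) y = a * B x y.
Proof. by rewrite /bform -!scalemxAl mxE. Qed.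

Lemma bformNl x y : B (- x) y = - B x y.
Proof. by rewrite -scaleN1r bformZl mulN1r. Qed.

Lemma bformDr x y z : B z (x + y) = B z x + B z y.
Proof. by rewrite bformC bformDl !(bformC _ z). Qed.

Lemma bformZr a x y : B y (a *: x) = a * B y x.
Proof. by rewrite bformC bformZl bformC. Qed.

Lemma bformNr x y : B y (- x) = - B y x.
Proof. by rewrite bformC bformNl bformC. Qed.

Lemma isometryP S :
  (forall x y, B (x *m S) (y *m S) = B x y) <-> S *m G *m S^T = G.
Proof.
split=> [SB|SG x y]; last by rewrite /bform trmx_mul !mulmxA -[in RHS]SG !mulmxA.
apply/matrixP => i j; have := SB (delta_mx 0 i) (delta_mx 0 j).
rewrite /bform trmx_mul !mulmxA -(mulmxA _ S) -(mulmxA _ (S *m G)).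
by rewrite -!rowE trmx_delta -!colE !mxE.
Qed.

Lemma mul_symmetry_mx x v : x *m sym v = x - (2 * B x v / Q v) *: v.
Proof.
rewrite /symmetry_mx mulmxBr mulmx1 -scalemxAr !mulmxA; congr (_ - _).
by rewrite [x *m G *m v^T]mx11_scalar mul_scalar_mx scalerA mulrAC.
Qed.

Lemma symmetry_isometry v x y : Q v != 0 -> B (x *m sym v) (y *m sym v) = B x y.
Proof.
move=> v0; rewrite !mul_symmetry_mx !(bformDl, bformDr, bformNl, bformNr).
rewrite !(bformZl, bformZr) (bformC v y) -[B v v]/(Q v).
by field.
Qed.

Lemma symmetryK v : Q v != 0 -> sym v *m sym v = 1%:M.
Proof.
move=> v0; apply/row_matrixP => i; rewrite row_mul !mul_symmetry_mx row1.
rewrite rowE !mul_symmetry_mx.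
rewrite bformDl bformNl bformZl -[B v v]/(Q v) -addrA -opprD -scalerDl.
set b := B _ _; have -> : 2 * b / Q v + 2 * (b - 2 * b / Q v * Q v) / Q v = 0.
  by field.
by rewrite scale0r subr0.
Qed.

Lemma symmetry_opp v : Q v != 0 -> v *m sym v = - v.
Proof.
move=> v0; rewrite mul_symmetry_mx -[B v v]/(Q v) mulfK //.
by rewrite scaler_nat mulr2n opprD addrA subrr sub0r.
Qed.

Lemma symmetry_orthogonal x v : B x v = 0 -> x *m sym v = x.
Proof. by move=> xv; rewrite mul_symmetry_mx xv mulr0 mul0r scale0r subr0. Qed.

(** Sylvester's identity det (1 - u w) = det (1 - w u) = 1 - 2. *)
Lemma det_symmetry v : Q v != 0 -> \det (sym v) = -1.
Proof.
move=> v0; pose u := (2 / Q v) *: (G *m v^T).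
have -> : sym v = 1%:M - u *m v by rewrite /symmetry_mx /u scalemxAl.
have vu : v *m u = 2%:M.
  rewrite /u -scalemxAr mulmxA [v *m G *m v^T]mx11_scalar -[_ 0 0]/(Q v).
  by rewrite scale_scalar_mx divfK.
have eq1 : block_mx (1%:M - u *m v) u 0 1%:M *m block_mx 1%:M 0 v 1%:M =
    block_mx 1%:M u v 1%:M.
  rewrite mulmx_block !mulmx1 !mul1mx !mulmx0 ?mul0mx !add0r subrK.
  by rewrite ?addr0.
have eq2 : block_mx 1%:M 0 v 1%:M *m block_mx 1%:M u 0 (1%:M - v *m u) =
    block_mx 1%:M u v 1%:M.
  rewrite mulmx_block !mulmx1 !mul1mx !mulmx0 ?mul0mx !addr0 addrC subrK.
  by rewrite ?add0r.
have := congr1 determinant (etrans eq1 (esym eq2)).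
rewrite !det_mulmx !(det_ublock, det_lblock) !det1 !mulr1 !mul1r => ->.
by rewrite vu -raddfB /= det_scalar expr1; ring.
Qed.

End Symmetries.

Section SpinorKernel.
Variables (F : fieldType) (G : 'M[F]_3).
Hypothesis G_sym : G^T = G.
Hypothesis two_neq0 : 2 != 0 :> F.
Implicit Types (x y v : 'rV[F]_3) (S T : 'M[F]_3) (vs : seq 'rV[F]_3).
Local Notation B := (bform G).
Local Notation Q := (qform G).
Local Notation sym := (symmetry_mx G).
Local Notation symprod vs := (\prod_(v <- vs) sym v).
Local Notation anisotropic vs := (forall v, v \in vs -> Q v != 0).

Lemma anisotropic_cons v vs :
  anisotropic (v :: vs) <-> Q v != 0 /\ anisotropic vs.
Proof.
split=> [h|[v0 h] w]; last by rewrite inE => /orP[/eqP ->|/h].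
by split=> [|w wvs]; apply: h; rewrite inE ?eqxx // wvs orbT.
Qed.

Lemma anisotropic_cat vs ws :
  anisotropic vs -> anisotropic ws -> anisotropic (vs ++ ws).
Proof. by move=> hv hw v; rewrite mem_cat => /orP[/hv|/hw]. Qed.

Lemma anisotropic_rev vs : anisotropic vs -> anisotropic (rev vs).
Proof. by move=> h v; rewrite mem_rev; apply: h. Qed.

Lemma symprod_rev vs : anisotropic vs -> symprod vs *m symprod (rev vs) = 1%:M.
Proof.
elim: vs => [|v vs IHvs] h; first by rewrite big_nil mulmx1.
have [v0 {}h] := (anisotropic_cons _ _).1 h.
rewrite rev_cons -cats1 big_cat big_seq1 big_cons -!mulmxE -mulmxA.
by rewrite (mulmxA (symprod vs)) IHvs // mul1mx symmetryK.
Qed.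

Lemma det_symprod vs : anisotropic vs -> \det (symprod vs) = (-1) ^+ size vs.
Proof.
elim: vs => [|v vs IHvs] h; first by rewrite big_nil det1.
have [v0 {}h] := (anisotropic_cons _ _).1 h.
by rewrite big_cons -mulmxE det_mulmx det_symmetry // IHvs // exprS.
Qed.

Lemma special_orthogonalP S :
  special_orthogonal_group G S <-> S *m G *m S^T = G /\ \det S = 1.
Proof.
split=> [[[uS /isometryP SG] dS]|[/isometryP SG dS]] //.
by split=> //; split=> //; rewrite unitmxE dS unitr1.
Qed.

Lemma special_orthogonal1 : special_orthogonal_group G 1%:M.
Proof. by apply/special_orthogonalP; rewrite mul1mx trmx1 mulmx1 det1. Qed.

Lemma special_orthogonalM S T : special_orthogonal_group G S ->
  special_orthogonal_group G T -> special_orthogonal_group G (S *m T).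
Proof.
move=> /special_orthogonalP[SG dS] /special_orthogonalP[TG dT].
apply/special_orthogonalP; rewrite det_mulmx dS dT mulr1; split=> //.
by rewrite trmx_mul !mulmxA -(mulmxA S) -(mulmxA S) TG SG.
Qed.

Lemma special_orthogonal_unit S : special_orthogonal_group G S -> S \in unitmx.
Proof. by case=> -[]. Qed.

Lemma special_orthogonalV S : special_orthogonal_group G S ->
  special_orthogonal_group G (invmx S).
Proof.
move=> SO; have uS := special_orthogonal_unit SO.
have [SG dS] := (special_orthogonalP _).1 SO.
apply/special_orthogonalP; rewrite det_inv dS invr1; split=> //.
by rewrite -[in LHS]SG trmx_inv !mulmxA mulVmx // mul1mx mulmxK ?unitmx_tr.
Qed.

Lemma symprod_spinor_kernel S vs : special_orthogonal_group G S ->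
  anisotropic vs -> S = symprod vs ->
  (exists2 c, c != 0 & 1 = c ^+ 2 * \prod_(v <- vs) Q v) -> spinor_kernel G S.
Proof. by move=> SO h SE c; split=> //; exists vs. Qed.

Lemma spinor_kernel_special S : spinor_kernel G S -> special_orthogonal_group G S.
Proof. by case. Qed.

Lemma spinor_kernel1 : spinor_kernel G 1%:M.
Proof.
apply: (@symprod_spinor_kernel _ [::]) => //; rewrite ?big_nil //.
  exact: special_orthogonal1.
by exists 1; rewrite ?oner_neq0 // expr1n mulr1.
Qed.

Lemma spinor_kernelM S T : spinor_kernel G S -> spinor_kernel G T ->
  spinor_kernel G (S *m T).
Proof.
move=> [SO [vs [hv SE [c c0 cE]]]] [TO [ws [hw TE [d d0 dE]]]].
apply: (@symprod_spinor_kernel _ (vs ++ ws)).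
- exact: special_orthogonalM.
- exact: anisotropic_cat.
- by rewrite big_cat SE TE.
exists (c * d); first by rewrite mulf_neq0.
by rewrite big_cat /= exprMn mulrACA -cE -dE mulr1.
Qed.

Lemma spinor_kernelV S : spinor_kernel G S -> spinor_kernel G (invmx S).
Proof.
move=> [SO [vs [hv SE [c c0 cE]]]].
have uS := special_orthogonal_unit SO.
apply: (@symprod_spinor_kernel _ (rev vs)).
- exact: special_orthogonalV.
- exact: anisotropic_rev.
- by rewrite -[LHS]mulmx1 -(symprod_rev hv) -SE mulKmx.
by exists c; rewrite // (perm_big vs) //= perm_rev.
Qed.

Variable e : 'I_3 -> 'rV[F]_3.
Hypothesis e_orth : forall i j, i != j -> B (e i) (e j) = 0.
Hypothesis e_aniso : forall i, Q (e i) != 0.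
Hypothesis e_unit : \matrix_i e i \in unitmx.

(** Reflections carry [x] to [y] whenever [Q x = Q y <> 0], since
    [Q (x - y) + Q (x + y) = 4 Q y]. *)
Lemma symmetry_transitive x y : Q x = Q y -> Q y != 0 ->
  exists vs, [/\ anisotropic vs, x *m symprod vs = y &
    forall z, B z x = 0 -> B z y = 0 -> z *m symprod vs = z].
Proof.
move=> xy y0; have sumQ : Q (x - y) + Q (x + y) = 4 * Q y.
  rewrite /qform !(bformDl, bformDr, bformNl, bformNr) // -!/(Q _) xy.
  rewrite (bformC G_sym y x); ring.
have [xy0|xy0] := eqVneq (Q (x - y)) 0.
  have xy1 : Q (x + y) != 0.
    move: sumQ; rewrite xy0 add0r => ->.
    by rewrite mulf_neq0 // (_ : 4 = 2 * 2) ?mulf_neq0 //; ring.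
  (* With [x - y] isotropic, the symmetry in [x + y] sends [x] to [- y], and the symmetry in [y]
     corrects the sign. *)
  exists [:: x + y; y]; split.
  - by apply/anisotropic_cons; split=> //; apply/anisotropic_cons; split.
  - rewrite big_cons big_seq1 -mulmxE mulmxA.
    suff -> : x *m sym (x + y) = - y by rewrite mulNmx symmetry_opp // opprK.
    rewrite mul_symmetry_mx (_ : 2 * _ / _ = 1).
      by rewrite scale1r opprD addrA subrr sub0r.
    apply: (canLR (mulfK xy1)); rewrite mul1r /qform.
    rewrite !(bformDl, bformDr) // -!/(Q _) xy (bformC G_sym y x); ring.
  - move=> z zx zy; rewrite big_cons big_seq1 -mulmxE mulmxA.
    by rewrite !symmetry_orthogonal // bformDr // zx zy addr0.
exists [:: x - y]; split.
- by apply/anisotropic_cons.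
- rewrite big_seq1 mul_symmetry_mx (_ : 2 * _ / _ = 1).
    by rewrite scale1r opprB addrC subrK.
  apply: (canLR (mulfK xy0)); rewrite mul1r /qform.
  rewrite !(bformDl, bformDr, bformNl, bformNr) // -!/(Q _) xy.
  rewrite (bformC G_sym y x); ring.
move=> z zx zy; rewrite big_seq1 symmetry_orthogonal //.
by rewrite bformDr // bformNr // zx zy subrr.
Qed.

Lemma symprod_bform vs x y : anisotropic vs ->
  B (x *m symprod vs) (y *m symprod vs) = B x y.
Proof.
elim: vs x y => [|v vs IHvs] x y h; first by rewrite big_nil !mulmx1.
have [v0 {}h] := (anisotropic_cons _ _).1 h.
by rewrite big_cons -mulmxE !mulmxA IHvs // symmetry_isometry.
Qed.

(** The vectors of the orthogonal basis are brought back to themselves one at a time, by symmetries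
    that do not disturb those already fixed. Once all three are fixed, the product of [S] with these
    symmetries is the identity. *)
Lemma Cartan_Dieudonne S : special_orthogonal_group G S ->
  exists2 vs, anisotropic vs & S = symprod vs.
Proof.
move=> [[uS SB] _].
have step k : (k <= 3)%N -> exists2 vs, anisotropic vs &
    forall i : 'I_3, (i < k)%N -> e i *m (S *m symprod vs) = e i.
  elim: k => [|k IHk] k3; first by exists [::].
  have [vs hv fixe] := IHk (ltnW k3); pose K := Ordinal k3.
  have TB x y : B (x *m (S *m symprod vs)) (y *m (S *m symprod vs)) = B x y.
    by rewrite !mulmxA symprod_bform.
  have [|ws [hw eK fixw]] :=
    @symmetry_transitive (e K *m (S *m symprod vs)) (e K) _ (e_aniso K).
    by rewrite /qform TB.
  exists (vs ++ ws); first exact: anisotropic_cat.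
  move=> i; rewrite ltnS leq_eqVlt => /orP[/eqP iK|ik].
    have -> : i = K by exact/val_inj.
    by rewrite big_cat /= -mulmxE !mulmxA -(mulmxA (e K)) eK.
  (* [e i] is already fixed by the isometry, so it is orthogonal to [e K] and to the image of [e K];
     the new symmetries then leave it fixed. *)
  have iK : i != K by apply: contraTneq ik => ->; rewrite ltnn.
  rewrite big_cat /= -mulmxE !mulmxA -(mulmxA (e i)) fixe // fixw ?e_orth //.
  by rewrite -{1}(fixe i ik) TB e_orth.
have [vs hv fixe] := step 3 (leqnn 3).
exists (rev vs); first exact: anisotropic_rev.
have Svs : S *m symprod vs = 1%:M.
  rewrite -[LHS](mulKmx e_unit) -[RHS](mulKmx e_unit) mulmx1; congr (_ *m _).
  by apply/row_matrixP => i; rewrite row_mul rowK fixe.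
by rewrite -[LHS]mulmx1 -(symprod_rev hv) mulmxA Svs mul1mx.
Qed.

(** In the word [vs ws vs^-1 ws^-1] every vector occurs twice, so the product of the values of [Q]
    is a square. *)
Lemma spinor_kernel_commutator S T : special_orthogonal_group G S ->
  special_orthogonal_group G T ->
  spinor_kernel G (S *m T *m invmx S *m invmx T).
Proof.
move=> SO TO; have uS := special_orthogonal_unit SO.
have uT := special_orthogonal_unit TO.
have [[vs hv SE] [ws hw TE]] := (Cartan_Dieudonne SO, Cartan_Dieudonne TO).
apply: (@symprod_spinor_kernel _ (vs ++ ws ++ rev vs ++ rev ws)).
- by do !apply: special_orthogonalM => //; exact: special_orthogonalV.
- by do !apply: anisotropic_cat => //; exact: anisotropic_rev.
- rewrite !big_cat /= -!mulmxE -SE -TE !mulmxA; congr (_ *m _ *m _).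
    by rewrite -[LHS]mulmx1 -(symprod_rev hv) -SE mulKmx.
  by rewrite -[LHS]mulmx1 -(symprod_rev hw) -TE mulKmx.
have prod0 us : anisotropic us -> \prod_(v <- us) Q v != 0.
  by move=> hu; rewrite prodf_seq_neq0; apply/allP => v /hu.
exists ((\prod_(v <- vs) Q v) * (\prod_(v <- ws) Q v))^-1.
  by rewrite invr_neq0 // mulf_neq0 // prod0.
rewrite !big_cat /= !(perm_big _ (permEl (perm_rev _))) /=.
by field; rewrite !prod0.
Qed.

End SpinorKernel.

(** * Conjugation of rotations by a similitude *)

Section Similitudes.
Variables (F : fieldType) (G G' S0 : 'M[F]_3) (a : F).
Hypothesis two_neq0 : 2 != 0 :> F.
Hypothesis a_neq0 : a != 0.
Hypothesis S0_unit : S0 \in unitmx.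
Hypothesis S0_sim : S0 *m G *m S0^T = a *: G'.
Implicit Types (S : 'M[F]_3) (v : 'rV[F]_3).

Lemma qform_similitude v : qform G' (v *m invmx S0) = a^-1 * qform G v.
Proof.
apply: (canRL (mulKf a_neq0)); rewrite /qform /bform.
have <- : ((v *m invmx S0) *m (a *: G') *m (v *m invmx S0)^T) 0 0 =
    a * ((v *m invmx S0) *m G' *m (v *m invmx S0)^T) 0 0.
  by rewrite -scalemxAr -scalemxAl mxE.
rewrite -S0_sim trmx_mul trmx_inv !mulmxA mulmxKV // -(mulmxA _ S0^T).
by rewrite mulmxV ?unitmx_tr // mulmx1.
Qed.

(** A symmetry does not change when the form is scaled, so conjugation by [S0] acts only on its
    vector. *)
Lemma symmetry_similitude v :
  S0 *m symmetry_mx G v *m invmx S0 = symmetry_mx G' (v *m invmx S0).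
Proof.
rewrite /symmetry_mx qform_similitude mulmxBr mulmxBl mulmx1 mulmxV //.
congr (_ - _); rewrite -scalemxAr -scalemxAl.
have -> : G' = a^-1 *: (S0 *m G *m S0^T) by rewrite S0_sim scalerA mulVf ?scale1r.
rewrite -!scalemxAl scalerA trmx_mul trmx_inv !mulmxA -(mulmxA _ S0^T).
rewrite mulmxV ?unitmx_tr // mulmx1; congr (_ *: _).
by rewrite invfM invrK -!mulrA [_^-1 * a^-1]mulrC mulVKf.
Qed.

Lemma special_orthogonal_similitude S : special_orthogonal_group G S ->
  special_orthogonal_group G' (S0 *m S *m invmx S0).
Proof.
move=> /special_orthogonalP[SG dS]; apply/special_orthogonalP; split; last first.
  by rewrite !det_mulmx mulrAC -det_mulmx mulmxV // det1 mul1r.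
have -> : G' = a^-1 *: (S0 *m G *m S0^T) by rewrite S0_sim scalerA mulVf ?scale1r.
rewrite -scalemxAr -scalemxAl; congr (_ *: _).
rewrite !trmx_mul trmx_inv !mulmxA mulmxKV // -(mulmxA _ S0^T).
by rewrite mulmxV ?unitmx_tr // mulmx1 -[in RHS]SG !mulmxA.
Qed.

(** The spinor norm scales by a^(-r) for a product of r symmetries, and r is even. *)
Lemma spinor_kernel_similitude S : spinor_kernel G S ->
  spinor_kernel G' (S0 *m S *m invmx S0).
Proof.
move=> [SO [vs [hv SE [c c0 cE]]]].
have even_vs : ~~ odd (size vs).
  apply/negP => odd_vs; have [_] := SO; rewrite SE det_symprod //.
  rewrite -signr_odd odd_vs expr1 => N1; have /negP := two_neq0; apply.
  by apply/eqP; rewrite -[2]/(1 + 1) -{1}N1 addNr.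
apply: (@symprod_spinor_kernel _ _ _ [seq v *m invmx S0 | v <- vs]).
- exact: special_orthogonal_similitude.
- move=> _ /mapP[v /hv v0 ->]; rewrite qform_similitude.
  by rewrite mulf_neq0 ?invr_neq0.
- rewrite {}SE big_map; elim: vs {hv c0 cE even_vs} => [|v vs IHvs].
    by rewrite !big_nil mulmx1 mulmxV.
  rewrite !big_cons -!mulmxE -IHvs -symmetry_similitude !mulmxA.
  by rewrite mulmxKV.
have [k szE] : exists k, size vs = (k * 2)%N.
  exists (size vs)./2; rewrite muln2.
  by rewrite -[LHS]odd_double_half (negbTE even_vs).
exists (c * a ^+ k); first by rewrite mulf_neq0 // expf_neq0.
have -> : \prod_(w <- [seq v *m invmx S0 | v <- vs]) qform G' w =
    a^-1 ^+ size vs * \prod_(v <- vs) qform G v.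
  elim: (vs) => [|v ws IHws]; first by rewrite !big_nil mulr1.
  by rewrite /= !big_cons IHws qform_similitude exprS mulrACA.
rewrite szE exprM exprVn exprMn {1}cE; field.
by rewrite expf_neq0.
Qed.

End Similitudes.

(** * Rational orthogonal bases and the local spinor kernels *)

Lemma nonzero_kernel (F : fieldType) m n (A : 'M[F]_(m, n)) : (n < m)%N ->
  exists2 v : 'rV[F]_m, v != 0 & v *m A = 0.
Proof.
move=> nm; exists (nz_row (kermx A)).
  rewrite nz_row_eq0 -mxrank_eq0 mxrank_ker subn_eq0 -ltnNge.
  exact: leq_ltn_trans (rank_leq_col A) nm.
by apply: sub_kermxP; exact: nz_row_sub.
Qed.

(** Each new vector solves at most two linear equations in three unknowns, so a nonzero solution
    exists; positivity makes it anisotropic. Independence follows because the Gram matrix of the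
    three vectors is diagonal with nonzero entries. *)
Lemma orthogonal_basis (G : 'M[rat]_3) : G^T = G ->
  (forall x : 'rV[rat]_3, x != 0 -> 0 < qform G x) ->
  exists e : 'I_3 -> 'rV[rat]_3, [/\ forall i j, i != j -> bform G (e i) (e j) = 0,
    forall i, 0 < qform G (e i) & \matrix_i e i \in unitmx].
Proof.
move=> G_sym posG.
have [e0 e0n0 _] := @nonzero_kernel rat 3 0 0 isT.
have [e1 e1n0 e1K] := @nonzero_kernel rat 3 1 (G *m e0^T) isT.
have [e2 e2n0 e2K] := @nonzero_kernel rat 3 (1 + 1) (row_mx (G *m e0^T) (G *m e1^T)) isT.
have e10 : bform G e1 e0 = 0 by rewrite /bform -mulmxA e1K mxE.
have [e20 e21] : bform G e2 e0 = 0 /\ bform G e2 e1 = 0.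
  move: e2K; rewrite mul_mx_row -row_mx0 => /eq_row_mx[e20 e21].
  by rewrite /bform -!mulmxA e20 e21 !mxE.
pose e (i : 'I_3) := nth 0 [:: e0; e1; e2] i.
have e_orth i j : i != j -> bform G (e i) (e j) = 0.
  case: i j => [[|[|[|//]]] hi] [[|[|[|//]]] hj] //= _;
  by rewrite /e /= // bformC.
have e_pos i : 0 < qform G (e i).
  by apply: posG; case: i => [[|[|[|//]]] hi].
exists e; split=> //; pose P := \matrix_i e i.
pose D : 'rV[rat]_3 := \row_i qform G (e i).
have PGP : P *m G *m P^T = diag_mx D.
  apply/matrixP => i j; rewrite !mxE.
  have -> : \sum_k (P *m G) i k * P^T k j = bform G (e i) (e j).
    rewrite /bform !mxE; apply: eq_bigr => k _; rewrite !mxE; congr (_ * _).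
    by apply: eq_bigr => l _; rewrite !mxE.
  by have [->|ij] := eqVneq i j; rewrite ?mulr1n // e_orth.
have : diag_mx D \in unitmx.
  rewrite unitmxE det_diag unitfE; apply/prodf_neq0 => i _.
  by rewrite mxE lt0r_neq0.
by rewrite -PGP !unitmx_mul => /andP[/andP[]].
Qed.

Lemma padicNum_two_neq0 (p : primeNat) : 2 != 0 :> padicNum p.
Proof. by rewrite (intr_padicNum_inj p 2). Qed.

Lemma bform_map (p : primeNat) (G : 'M[rat]_3) x y :
  bform (map_mx (qp p) G) (map_mx (qp p) x) (map_mx (qp p) y) = qp p (bform G x y).
Proof. by rewrite /bform map_trmx -!map_mxM mxE. Qed.

Lemma linear_imageK (F : fieldType) (A B : set 'rV[F]_3) (S : 'M[F]_3) :
  S \in unitmx -> A = linear_image S B -> B = linear_image (invmx S) A.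
Proof. by move=> uS ->; rewrite linear_imageM mulmxV // linear_image1. Qed.

Definition positive_form (G : 'M[rat]_3) : Prop :=
  forall x : 'rV[rat]_3, x != 0 -> 0 < qform G x.

Section LocalSpinorKernel.
Variables (G : 'M[rat]_3) (p : primeNat).
Hypothesis G_sym : G^T = G.
Hypothesis G_pos : positive_form G.
Local Notation Gp := (map_mx (qp p) G).
Local Notation SO := (special_orthogonal_group Gp).
Implicit Types S T : 'M[padicNum p]_3.

Lemma local_special_orthogonal (T : 'M[rat]_3) : special_orthogonal_group G T ->
  SO (map_mx (qp p) T).
Proof.
move=> /special_orthogonalP[TG dT]; apply/special_orthogonalP.
by rewrite map_trmx -!map_mxM TG det_map_mx dT rmorph1.
Qed.

(** The form may become isotropic over the p-adic numbers; an orthogonal basis chosen over the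
    rationals nevertheless stays anisotropic there, since [qp] is injective. *)
Lemma local_commutator S T : SO S -> SO T ->
  spinor_kernel Gp (S *m T *m invmx S *m invmx T).
Proof.
have [e [e_orth e_pos e_unit]] := orthogonal_basis G_sym G_pos.
apply: (@spinor_kernel_commutator _ _ _ _ (fun i => map_mx (qp p) (e i))).
- by rewrite map_trmx G_sym.
- exact: padicNum_two_neq0.
- by move=> i j ij; rewrite bform_map e_orth // rmorph0.
- by move=> i; rewrite /qform bform_map fmorph_eq0 lt0r_neq0 // e_pos.
have -> : \matrix_i map_mx (qp p) (e i) = map_mx (qp p) (\matrix_i e i).
  by apply/matrixP => i j; rewrite !mxE.
by rewrite map_unitmx.
Qed.

(** [T S T^-1 = (T S T^-1 S^-1) S], a commutator times an element of the kernel. *)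
Lemma local_normal S T : spinor_kernel Gp S -> SO T ->
  spinor_kernel Gp (T *m S *m invmx T).
Proof.
move=> SK TO; have SO := spinor_kernel_special SK.
have uS := special_orthogonal_unit SO.
rewrite -[X in spinor_kernel _ X](mulmxKV uS).
exact: spinor_kernelM (local_commutator TO SO) SK.
Qed.

End LocalSpinorKernel.

(** * Spinor genera and families of local rotations *)

Lemma invmxM (F : fieldType) n (A B : 'M[F]_n) : A \in unitmx -> B \in unitmx ->
  invmx (A *m B) = invmx B *m invmx A.
Proof.
move=> uA uB; have uAB : A *m B \in unitmx by rewrite unitmx_mul uA.
apply: (can_inj (mulKmx uAB)).
by rewrite mulmxV // !mulmxA mulmxK // mulmxV.
Qed.

(** The dimension is kept variable: for 3 x 3 matrices, unification would unfold
    the determinants inside [invmx]. *)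
Section InvertibleMatrices.
Variables (F : fieldType) (n : nat).
Implicit Types A B S T X Y Z : 'M[F]_n.

Lemma mulmx_conj_split S A T B : A \in unitmx -> B \in unitmx ->
  S *m A *m (T *m B) *m invmx (A *m B) = S *m (A *m T *m invmx A).
Proof. by move=> uA uB; rewrite invmxM // !mulmxA (mulmxK uB). Qed.

Lemma mulmx_conj_commutator S T A : S \in unitmx ->
  invmx S *m (T *m A) *m S *m invmx A =
  (invmx S *m T *m invmx (invmx S)) *m
  (invmx S *m A *m invmx (invmx S) *m invmx A).
Proof. by move=> uS; rewrite invmxK !mulmxA (mulmxK uS). Qed.

(** With [W = Y Z^-1] and [[A, B] = A B A^-1 B^-1], the right side is [[X^-1, W] [Y, Z^-1]]. This
    measures how far [X Y^-1 Z] is from [Z Y^-1 X]. *)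
Lemma heap_commutators X Y Z : X \in unitmx -> Y \in unitmx -> Z \in unitmx ->
  invmx (Z *m invmx Y *m X) *m (X *m invmx Y *m Z) =
  (invmx X *m (Y *m invmx Z) *m invmx (invmx X) *m invmx (Y *m invmx Z)) *m
  (Y *m invmx Z *m invmx Y *m invmx (invmx Z)).
Proof.
move=> uX uY uZ.
rewrite !invmxM ?unitmx_mul ?unitmx_inv ?uX ?uY ?uZ // !invmxK !mulmxA.
by rewrite (mulmxKV uY) (mulmxK uZ).
Qed.

Lemma invmx_heap X Y Z : X \in unitmx ->
  invmx X *m (X *m invmx Y *m Z) = invmx Y *m Z.
Proof. by move=> uX; rewrite -mulmxA (mulKmx uX). Qed.

Lemma heap_cancel X Y Z : Y \in unitmx -> Z \in unitmx ->
  X *m invmx Y *m Z *m invmx Z *m Y = X.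
Proof. by move=> uY uZ; rewrite (mulmxK uZ) (mulmxKV uY). Qed.

End InvertibleMatrices.

Definition family := forall p : primeNat, 'M[padicNum p]_3.

Definition family_conj (S0 : 'M[rat]_3) (s : family) : family :=
  fun p => map_mx (qp p) S0 *m s p *m invmx (map_mx (qp p) S0).

(** The torsor operation [x y^-1 z]: it encodes product and inverse at once and refers to no
    identity element. *)
Definition family_heap (x y z : family) : family :=
  fun p => x p *m invmx (y p) *m z p.

Definition moves (L K : zlattice) (s : family) : Prop :=
  gram K = gram L /\
  forall p, local_carrier p K = linear_image (s p) (local_carrier p L).

Definition SO_family (G : 'M[rat]_3) (s : family) : Prop :=
  forall p, special_orthogonal_group (map_mx (qp p) G) (s p).

(** Whether [s] carries lattices to lattices can be tested on any one lattice; in this form the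
    restricted product condition is used throughout. *)
Lemma transport_lattice (L L' K : zlattice) (s : family) :
  (forall p, local_carrier p L' = linear_image (s p) (local_carrier p L)) ->
  exists K', moves K K' s.
Proof.
move=> LL'; have [E uE LE] := zlattice_basis L.
have [E' uE' LE'] := zlattice_basis L'; have [F uF KF] := zlattice_basis K.
have [|F' uF' F'E] := @lattice_transport E F E' s uE uF uE'.
  by move=> p; rewrite -(local_carrierE p LE') LL' (local_carrierE p LE) linear_image_lat.
have full : is_full_lattice (zlat F') by exists F'.
exists (ZLattice (gram_sym K) full); split=> // p.
by rewrite (@local_carrierE p _ F') // F'E (local_carrierE p KF) linear_image_lat.
Qed.

Lemma image_lattice (L : zlattice) (G S : 'M[rat]_3) : G^T = G -> S \in unitmx ->
  exists K, [/\ gram K = G, carrier K = linear_image S (carrier L) &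
    forall p, local_carrier p K =
      linear_image (map_mx (qp p) S) (local_carrier p L)].
Proof.
move=> G_sym uS; have [E uE LE] := zlattice_basis L.
have full : is_full_lattice (zlat (E *m S)).
  by exists (E *m S); rewrite // unitmx_mul uE.
exists (ZLattice G_sym full); split=> //=; first by rewrite LE linear_image_lat.
move=> p; rewrite (@local_carrierE p _ (E *m S)) //.
by rewrite (local_carrierE p LE) map_mxM linear_image_lat.
Qed.

Section SpinorGenera.
Variable G : 'M[rat]_3.
Hypothesis G_sym : G^T = G.
Hypothesis G_pos : positive_form G.
Local Notation Theta p := (spinor_kernel (map_mx (qp p) G)).
Local Notation SO p := (special_orthogonal_group (map_mx (qp p) G)).
Implicit Types (L K : zlattice) (s x y z : family).

Lemma moves_trans L K K' s x : moves L K s -> moves K K' x ->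
  moves L K' (fun p => s p *m x p).
Proof.
move=> [gK sK] [gK' xK']; split=> [|p]; first by rewrite gK' gK.
by rewrite xK' sK linear_imageM.
Qed.

Lemma moves_inv L K s : (forall p, s p \in unitmx) -> moves L K s ->
  moves K L (fun p => invmx (s p)).
Proof. move=> us [gK sK]; split=> [|p]; first by rewrite gK.
exact: linear_imageK (us p) (sK p). Qed.

Lemma moves_eq L K s x : s = x -> moves L K s -> moves L K x.
Proof. by move=> ->. Qed.

Lemma psgI L K (T : 'M[rat]_3) s : gram L = G -> special_orthogonal_group G T ->
  moves L K s -> (forall p, Theta p (s p *m invmx (map_mx (qp p) T))) ->
  proper_spinor_genus L K.
Proof.
move=> gL TO [gK sK] sT; split=> //; exists T; first by rewrite gL.
move=> p; exists (s p *m invmx (map_mx (qp p) T)).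
  by rewrite /local_gram gL; exact: sT.
rewrite linear_imageM -[map_mx ratr T]/(map_mx (qp p) T) mulmxKV //.
by rewrite map_unitmx; exact: special_orthogonal_unit TO.
Qed.

Lemma psgE L K : gram L = G -> proper_spinor_genus L K ->
  exists T s, [/\ special_orthogonal_group G T, forall p, Theta p (s p) &
    moves L K (fun p => s p *m map_mx (qp p) T)].
Proof.
move=> gL [gK [T TO sK]]; rewrite gL in TO.
have sP p : exists S, Theta p S /\
    local_carrier p K = linear_image (S *m map_mx (qp p) T) (local_carrier p L).
  have [S SK KE] := sK p; exists S; split; last by rewrite KE linear_imageM.
  by move: SK; rewrite /local_gram gL.
exists T, (fun p => projT1 (cid (sP p))); split=> //.
  by move=> p; case: (cid (sP p)) => S [].
by split=> // p; case: (cid (sP p)) => S [].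
Qed.

Lemma psg_gram L K : gram L = G -> proper_spinor_genus L K -> gram K = G.
Proof. by move=> gL [-> _]. Qed.

Lemma psg_refl L : gram L = G -> proper_spinor_genus L L.
Proof.
move=> gL; apply: (@psgI _ _ 1%:M (fun=> 1%:M)) => //.
- exact: special_orthogonal1.
- by split=> // p; rewrite linear_image1.
by move=> p; rewrite map_mx1 invmx1 mulmx1; exact: spinor_kernel1.
Qed.

Let Theta_unit p S : Theta p S -> S \in unitmx.
Proof. by move/spinor_kernel_special/special_orthogonal_unit. Qed.

Let SO_unit p S : SO p S -> S \in unitmx.
Proof. exact: special_orthogonal_unit. Qed.

Lemma psg_sym L K : gram L = G -> proper_spinor_genus L K ->
  proper_spinor_genus K L.
Proof.
move=> gL LK; have gK := psg_gram gL LK.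
have [T [s [TO sT mLK]]] := psgE gL LK.
have TpO p : SO p (map_mx (qp p) T) by exact: local_special_orthogonal.
apply: (@psgI _ _ (invmx T) _ gK (special_orthogonalV TO) (moves_inv _ mLK)).
  by move=> p; rewrite unitmx_mul Theta_unit // (SO_unit (TpO p)).
move=> p; rewrite map_invmx invmxK.
have -> : invmx (s p *m map_mx (qp p) T) =
    invmx (map_mx (qp p) T) *m invmx (s p).
  by rewrite invmxM ?(SO_unit (TpO p)) ?Theta_unit.
rewrite -{2}(invmxK (map_mx (qp p) T)); apply: local_normal => //.
  exact: spinor_kernelV.
exact: special_orthogonalV.
Qed.

Lemma psg_trans L K K' : gram L = G -> proper_spinor_genus L K ->
  proper_spinor_genus K K' -> proper_spinor_genus L K'.
Proof.
move=> gL LK KK'; have gK := psg_gram gL LK.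
have [T [s [TO sT mLK]]] := psgE gL LK.
have [T' [s' [TO' sT' mKK']]] := psgE gK KK'.
have TpO p : SO p (map_mx (qp p) T) by exact: local_special_orthogonal.
have TpO' p : SO p (map_mx (qp p) T') by exact: local_special_orthogonal.
apply: (@psgI _ _ (T *m T') _ gL _ (moves_trans mLK mKK')).
  exact: special_orthogonalM.
move=> p; rewrite map_mxM.
move: (map_mx (qp p) T) (map_mx (qp p) T') (TpO p) (TpO' p) => A A' AO AO'.
(* [s T s' T' = s (T s' T^-1) T T']: normality of the spinor kernel lets [s'] pass the rational
   rotation [T]. *)
rewrite mulmx_conj_split ?(SO_unit AO) ?(SO_unit AO') //.
by apply: spinor_kernelM => //; exact: local_normal.
Qed.

Lemma psg_eqP L K : gram L = G -> gram K = G ->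
  proper_spinor_genus L = proper_spinor_genus K <-> proper_spinor_genus L K.
Proof.
move=> gL gK; split=> [->|LK]; first exact: psg_refl.
apply/seteqP; split=> K' h; last exact: psg_trans LK h.
by apply: psg_trans h => //; exact: psg_sym.
Qed.

(** Makes the action of rotations on spinor genera well defined. If [k T] carries [L] to [L'], then
    [s^-1 k T s] carries [K] to [K'], and up to [T] this is a conjugate of [k] times a
    commutator. *)
Lemma psg_moves L L' K K' s : gram L = G -> SO_family G s ->
  moves L K s -> moves L' K' s -> proper_spinor_genus L L' ->
  proper_spinor_genus K K'.
Proof.
move=> gL sO mLK mLK' LL'; have gK : gram K = G by case: mLK => ->.
have us p : s p \in unitmx by exact: SO_unit (sO p).
have [T [k [TO kT mLL']]] := psgE gL LL'.
have TpO p : SO p (map_mx (qp p) T) by exact: local_special_orthogonal.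
have mKK' := moves_trans (moves_trans (moves_inv us mLK) mLL') mLK'.
apply: (@psgI _ _ T _ gK TO mKK') => p /=.
move: (map_mx (qp p) T) (TpO p) => A AO.
rewrite mulmx_conj_commutator ?us //.
apply: spinor_kernelM; first by apply: local_normal => //; exact: special_orthogonalV.
by apply: local_commutator => //; exact: special_orthogonalV.
Qed.

Lemma psg_kernel L K s : gram L = G -> moves L K s -> (forall p, Theta p (s p)) ->
  proper_spinor_genus L K.
Proof.
move=> gL mLK sT; apply: (@psgI _ _ 1%:M _ gL (special_orthogonal1 _) mLK) => p.
by rewrite map_mx1 invmx1 mulmx1.
Qed.

End SpinorGenera.

(** The adelic rotations: existence of [K] amounts to [s_p] stabilising [L_p] for almost all [p]. *)
Definition admissible (L : zlattice) (s : family) : Prop :=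
  SO_family (gram L) s /\ exists K, moves L K s.

(** The spinor genus of [L s], written without choosing a lattice [L s]. *)
Definition family_class (L : zlattice) (s : family) : set zlattice :=
  [set K | exists2 L', moves L L' s & proper_spinor_genus L' K].

Lemma local_carrierN (p : primeNat) (L : zlattice) (S : 'M[padicNum p]_3) :
  linear_image (- S) (local_carrier p L) = linear_image S (local_carrier p L).
Proof.
have carrierN x : local_carrier p L x -> local_carrier p L (- x).
  have [E _ LE] := zlattice_basis L; rewrite (local_carrierE p LE).
  by move=> [c _ <-]; exists (- c); rewrite // map_mxN mulNmx.
apply/seteqP; split=> _ [x /carrierN Lx <-]; exists (- x) => //.
  by rewrite mulNmx mulmxN.
by rewrite mulNmx mulmxN opprK.
Qed.

Lemma qform_unit (G : 'M[rat]_3) : G^T = G -> positive_form G -> G \in unitmx.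
Proof.
move=> G_sym G_pos; have [] := boolP (G \in unitmx) => // nuG.
have [v v0 vG] : exists2 v : 'rV_3, v != 0 & v *m G = 0.
  exists (nz_row (kermx G)); last by apply: sub_kermxP; exact: nz_row_sub.
  rewrite nz_row_eq0 -mxrank_eq0 mxrank_ker subn_eq0 -ltnNge.
  rewrite ltn_neqAle rank_leq_row andbT; apply: contra nuG => rG.
  by rewrite -row_free_unit.
by have := G_pos v v0; rewrite /qform /bform vG mul0mx mxE ltxx.
Qed.

Lemma isometry_det (F : fieldType) n (G S : 'M[F]_n) : G \in unitmx ->
  S *m G *m S^T = G -> \det S = 1 \/ \det S = -1.
Proof.
move=> uG SG; have : (\det S) ^+ 2 = 1.
  have dG : \det G != 0 by rewrite -unitfE -unitmxE.
  apply: (mulIf dG); rewrite mul1r -[RHS](congr1 determinant SG) !det_mulmx.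
  by rewrite det_tr expr2 [RHS]mulrAC.
by move=> /eqP; rewrite sqrf_eq1 => /orP[/eqP|/eqP]; [left|right].
Qed.

Lemma isometry_opp (F : fieldType) n (G S : 'M[F]_n) :
  S *m G *m S^T = G -> - S *m G *m (- S)^T = G.
Proof. by rewrite raddfN /= !mulNmx mulmxN opprK. Qed.

Lemma det_opp (F : fieldType) n (S : 'M[F]_n) : \det (- S) = (-1) ^+ n * \det S.
Proof. by rewrite -scaleN1r detZ. Qed.

Section SpinorClasses.
Variable L : zlattice.
Hypothesis L_pos : positive_form (gram L).
Implicit Types (K : zlattice) (s x y z a b : family).
Let G_sym := gram_sym L.

Lemma genus_moves K : genus L K -> exists2 s, admissible L s & moves L K s.
Proof.
move=> [gK KL].
have sP p : exists S, special_orthogonal_group (map_mx (qp p) (gram L)) S /\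
    local_carrier p K = linear_image S (local_carrier p L).
  have [S [uS SG] KS] := KL p.
  have {}SG := (isometryP _ _).1 SG.
  have uG : map_mx (qp p) (gram L) \in unitmx.
    by rewrite map_unitmx; exact: qform_unit.
  have [dS|dS] := isometry_det uG SG.
    by exists S; split=> //; apply/special_orthogonalP.
  (* In odd dimension [- S] has the opposite determinant, and it has the same effect on lattices. *)
  exists (- S); rewrite local_carrierN; split; last exact: KS.
  apply/special_orthogonalP; split; first exact: isometry_opp.
  by rewrite det_opp dS -signr_odd mulrNN mulr1.
pose s p := projT1 (cid (sP p)).
have sO : SO_family (gram L) s by move=> p; rewrite /s; case: cid => S [].
have mLK : moves L K s by split=> // p; rewrite /s; case: cid => S [].
by exists s => //; split=> //; exists K.
Qed.

Lemma moves_genus K s : SO_family (gram L) s -> moves L K s -> genus L K.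
Proof.
move=> sO [gK sK]; split=> // p; exists (s p) => //.
by have [] := sO p.
Qed.

Lemma family_classE K s : SO_family (gram L) s -> moves L K s ->
  family_class L s = proper_spinor_genus K.
Proof.
move=> sO mLK; have gK : gram K = gram L by case: mLK.
apply/seteqP; split=> K' => [[L' mLL' LK']|KK']; last by exists K.
apply: (psg_trans _ _ gK _ LK') => //.
by apply: (psg_moves _ _ (erefl (gram L)) sO mLK mLL') => //; exact: psg_refl.
Qed.

Lemma SO_heap x y z : SO_family (gram L) x -> SO_family (gram L) y ->
  SO_family (gram L) z -> SO_family (gram L) (family_heap x y z).
Proof.
move=> xO yO zO p; apply: special_orthogonalM => //.
by apply: special_orthogonalM => //; exact: special_orthogonalV.
Qed.

Lemma SO_family_unit s p : SO_family (gram L) s -> s p \in unitmx.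
Proof. by move=> /(_ p); exact: special_orthogonal_unit. Qed.

Lemma admissible_heap x y z : admissible L x -> admissible L y ->
  admissible L z -> admissible L (family_heap x y z).
Proof.
move=> [xO [Lx mx]] [yO [Ly my]] [zO [Lz mz]]; split; first exact: SO_heap.
have uy p : y p \in unitmx by exact: SO_family_unit.
have [Lxy mxy] := transport_lattice Lx (moves_inv uy my).2.
have [Lxyz mxyz] := transport_lattice Lxy mz.2.
exists Lxyz; exact: moves_trans (moves_trans mx mxy) mxyz.
Qed.

(** [L a] and [L b] share a spinor genus, and both are moved on by the same rotations [y^-1 z]. *)
Lemma family_class_transl a b y z : admissible L a -> admissible L b ->
  admissible L y -> admissible L z -> family_class L a = family_class L b ->
  family_class L (family_heap a y z) = family_class L (family_heap b y z).
Proof.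
move=> aA bA yA zA ab.
have [aO [La ma]] := aA; have [bO [Lb mb]] := bA.
have [yO [Ly my]] := yA; have [zO [Lz mz]] := zA.
have [ayzO [La' ma']] := admissible_heap aA yA zA.
have [byzO [Lb' mb']] := admissible_heap bA yA zA.
rewrite (family_classE ayzO ma') (family_classE byzO mb').
have gLa' : gram La' = gram L by case: ma'.
have gLb' : gram Lb' = gram L by case: mb'.
apply/(psg_eqP _ _ gLa' gLb') => //.
have ua p := SO_family_unit p aO; have ub p := SO_family_unit p bO.
have gLa : gram La = gram L by case: ma.
have gLb : gram Lb = gram L by case: mb.
pose yz : family := fun p => invmx (y p) *m z p.
have yzO : SO_family (gram L) yz.
  by move=> p; apply: special_orthogonalM => //; exact: special_orthogonalV.
have maa : moves La La' yz.
  apply: moves_eq (moves_trans (moves_inv ua ma) ma').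
  apply: functional_extensionality_dep => p.
  exact/invmx_heap/ua.
have mbb : moves Lb Lb' yz.
  apply: moves_eq (moves_trans (moves_inv ub mb) mb').
  apply: functional_extensionality_dep => p.
  exact/invmx_heap/ub.
apply: (psg_moves _ _ gLa yzO maa mbb) => //.
by apply/(psg_eqP _ _ gLa gLb) => //;
   rewrite -(family_classE aO ma) ab (family_classE bO mb).
Qed.

Lemma heap_yyz y z : SO_family (gram L) y -> family_heap y y z = z.
Proof.
move=> yO; apply: functional_extensionality_dep => p.
by rewrite /family_heap (mulmxV (SO_family_unit p yO)) mul1mx.
Qed.

Lemma heapK x y z : SO_family (gram L) y -> SO_family (gram L) z ->
  family_heap (family_heap x y z) z y = x.
Proof.
move=> yO zO; apply: functional_extensionality_dep => p.
exact: heap_cancel (SO_family_unit p yO) (SO_family_unit p zO).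
Qed.

Lemma family_class_heapl x y z : admissible L x -> admissible L y ->
  admissible L z -> family_class L x = family_class L y ->
  family_class L (family_heap x y z) = family_class L z.
Proof.
move=> xA yA zA xy; rewrite (family_class_transl xA yA yA zA xy) heap_yyz //.
by case: yA.
Qed.

(** The heap operation is commutative modulo commutators. *)
Lemma family_class_heapC x y z : admissible L x -> admissible L y ->
  admissible L z ->
  family_class L (family_heap x y z) = family_class L (family_heap z y x).
Proof.
move=> xA yA zA.
have [xO [Lx mx]] := xA; have [yO [Ly my]] := yA; have [zO [Lz mz]] := zA.
have [zyxO [K mK]] := admissible_heap zA yA xA.
have [xyzO [K' mK']] := admissible_heap xA yA zA.
rewrite (family_classE zyxO mK) (family_classE xyzO mK').
have gK : gram K = gram L by case: mK.
have gK' : gram K' = gram L by case: mK'.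
apply/esym/(psg_eqP _ _ gK gK') => //.
have uzyx p := SO_family_unit p zyxO.
apply: (psg_kernel gK (moves_trans (moves_inv uzyx mK) mK')) => p.
have xp := xO p; have yp := yO p; have zp := zO p.
have ux := special_orthogonal_unit xp; have uy := special_orthogonal_unit yp.
have uz := special_orthogonal_unit zp.
rewrite /family_heap (heap_commutators ux uy uz).
have zV := special_orthogonalV zp.
exact: spinor_kernelM
  (local_commutator G_sym L_pos (special_orthogonalV xp) (special_orthogonalM yp zV))
  (local_commutator G_sym L_pos yp zV).
Qed.

Lemma family_class_heapr x y z : admissible L x -> admissible L y ->
  admissible L z -> family_class L y = family_class L z ->
  family_class L (family_heap x y z) = family_class L x.
Proof.
by move=> xA yA zA yz; rewrite family_class_heapC // family_class_heapl.
Qed.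

End SpinorClasses.

(** * The index of a sublattice *)

Lemma card_setT_ord (T : finType) : [set: T] #= `I_#|T|.
Proof.
apply: card_eq_trans (card_esym card_II); apply: card_esym.
have <- : (@enum_val T predT) @` [set: 'I_#|T|] = [set: T].
  by apply/seteqP; split=> // x _; exists (enum_rank x); rewrite ?enum_rankK.
by apply: card_esym; apply: inj_card_eq => i j _ _; exact: enum_val_inj.
Qed.

Section Index.
Variables (E : 'M[rat]_3).
Hypothesis E_unit : E \in unitmx.

Lemma cosets_eq (B : set 'rV[rat]_3) x y : (forall u v, B u -> B v -> B (u - v)) ->
  B 0 -> [set x + z | z in B] = [set y + z | z in B] <-> B (x - y).
Proof.
move=> BB B0; have BN u : B u -> B (- u) by move=> Bu; rewrite -sub0r; exact: BB.
have BD u v : B u -> B v -> B (u + v).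
  by move=> Bu Bv; rewrite -(opprK v); apply: BB => //; exact: BN.
split=> [xy|Bxy].
  have : [set x + z | z in B] x by exists 0; rewrite ?addr0.
  by rewrite xy => -[z Bz <-]; rewrite addrC addKr.
apply/seteqP; split=> _ [z Bz <-].
  by exists (x - y + z); [exact: BD|rewrite addrA [y + _]addrC subrK].
exists (z - (x - y)); first exact: BB.
by rewrite opprB addrCA [x + _]addrC subrK addrC.
Qed.

Lemma diag_index (d : 'I_3 -> int) : (forall i, d i != 0) ->
  has_index (zlat E) (zlat (map_mx intr (diag_mx (\row_i d i)) *m E))
    (\prod_i `|d i|)%N.
Proof.
move=> d0; set D := diag_mx _; set B := zlat (_ *m E).
have B0 : B 0 by exists 0; rewrite // map_mx0 mul0mx.
have BB u v : B u -> B v -> B (u - v) by exact: latB.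
have BP (c : 'rV[int]_3) : B (map_mx intr c *m E) <-> forall i, (d i %| c 0%R i)%Z.
  split=> [[b _]|dv].
    rewrite mulmxA -map_mxM mul_mx_diag => /(can_inj (mulmxK E_unit)) bc i.
    by move/rowP/(_ i): bc; rewrite !mxE => /intr_inj <-; exact: dvdz_mull.
  exists (\row_i (c 0%R i %/ d i)%Z) => //; rewrite mulmxA -map_mxM mul_mx_diag.
  congr (map_mx _ _ *m _); apply/rowP => i; rewrite !mxE.
  by rewrite divzK.
(* Coset representatives: coordinate vectors whose entry at [i] lies in [[0, |d i|[]. *)
pose T : finType := {dffun forall i : 'I_3, 'I_`|d i|}.
pose pt (t : T) : 'rV[rat]_3 := map_mx intr (\row_i (t i : nat)%:Z) *m E.
have cardT : #|T| = (\prod_i `|d i|)%N.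
  rewrite card_dep_ffun foldrE big_map big_enum /=.
  by apply: eq_bigr => i _; rewrite card_ord.
rewrite /has_index -cardT; apply: card_eq_trans (card_setT_ord T).
have -> : cosets (zlat E) B = (fun t => [set pt t + z | z in B]) @` [set: T].
  apply/seteqP; split=> [_ [_ [c _ <-] <-]|_ [t _ <-]]; last first.
    by exists (pt t) => //; eexists.
  have lt_cd i : (`|(c 0%R i %% d i)%Z| < `|d i|)%N.
    by have := ltz_mod (c 0%R i) (d0 i); have := modz_ge0 (c 0%R i) (d0 i); lia.
  exists ([ffun i => Ordinal (lt_cd i)] : T) => //; apply/cosets_eq => //.
  rewrite /pt -mulmxBl -map_mxB; apply/BP => i; rewrite !mxE ffunE /=.
  rewrite gez0_abs ?modz_ge0 // -opprB rpredN.
  by rewrite {1}(divz_eq (c 0%R i) (d i)) addrK; exact: dvdz_mull.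
apply: inj_card_eq => t t' _ _ /cosets_eq-/(_ BB B0).
rewrite /pt -mulmxBl -map_mxB => /BP dv; apply/ffunP => i; apply/val_inj.
have := dv i; rewrite !mxE -eqz_mod_dvd.
have small (s : T) : ((s i : nat)%:Z %% d i)%Z = (s i : nat).
  by rewrite -modz_abs modz_small //; have := ltn_ord (s i); lia.
by rewrite !small eqz_nat => /eqP.
Qed.

Lemma int_unitmx_det (L : 'M[int]_3) : L \in unitmx -> `|\det L|%N = 1%N.
Proof. by rewrite unitmxE => /orP[]/eqP ->. Qed.

End Index.

(** The unimodular factors of the Smith form only change the bases of the two lattices, which leaves
    a diagonal matrix. *)
Lemma lattice_index (E : 'M[rat]_3) (A : 'M[int]_3) : E \in unitmx -> \det A != 0 ->
  has_index (zlat E) (zlat (map_mx intr A *m E)) `|\det A|.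
Proof.
move=> uE dA; have [L uL [R uR [d _ AE]]] := int_Smith_normal_form A.
pose e (i : 'I_3) : int := d`_i.
have DE : \matrix_(i, j) (d`_i *+ (i == j :> nat)) = diag_mx (\row_i e i).
  by apply/matrixP => i j; rewrite !mxE val_eqE.
rewrite DE in AE.
have dAE : `|\det A|%N = (\prod_(i < 3) `|e i|)%N.
  rewrite AE !det_mulmx det_diag !abszM !int_unitmx_det // mul1n muln1.
  by rewrite (big_morph absz abszM (erefl _)); apply: eq_bigr => i _; rewrite mxE.
have d0 i : e i != 0.
  have : (0 < `|\det A|)%N by rewrite absz_gt0.
  by rewrite dAE lt0n -absz_eq0; apply: contraNneq => di; rewrite (bigD1 i) //= di.
have uRE : map_mx intr R *m E \in unitmx by rewrite unitmx_mul map_mx_unit.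
have -> : zlat E = zlat (map_mx intr R *m E).
  by apply/esym/(lat_eqP intr_inj _ uRE); exists R.
have -> : zlat (map_mx intr A *m E) =
    zlat (map_mx intr (diag_mx (\row_i e i)) *m (map_mx intr R *m E)).
  have uA : map_mx intr A *m E \in unitmx.
    by rewrite unitmx_mul uE andbT unitmxE det_map_mx unitfE intr_eq0.
  by apply/(lat_eqP intr_inj _ uA); exists L; rewrite // AE !map_mxM !mulmxA.
by rewrite dAE; exact: diag_index.
Qed.

(** [a / b] and [b / a] are integral at every prime, hence integers with product 1, hence signs. *)
Lemma rat_local_units (a b : rat) : b != 0 ->
  (forall p, exists2 u : padicInt p, u \is a GRing.unit & qp p a = tofrac u * qp p b) ->
  a = b \/ a = - b.
Proof.
move=> b0 ab; have a0 : a != 0.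
  (* A single prime shows that [a] does not vanish; 2 is taken. *)
  pose p2 : primeNat := exist _ 2%N isT; have [u uu au] := ab p2.
  rewrite -(fmorph_eq0 (qp p2)) /= au mulf_neq0 ?fmorph_eq0 //.
  by rewrite tofrac_eq0; apply: contraTneq uu => ->; rewrite unitr0.
have [|m ma] := @rat_integral (a / b).
  move=> p; have [u _ au] := ab p; exists u.
  by rewrite rmorphM fmorphV /= au mulfK // fmorph_eq0.
have [|k kb] := @rat_integral (b / a).
  move=> p; have [u uu au] := ab p; exists u^-1.
  rewrite rmorphM fmorphV; apply: (canLR (mulfK _)); rewrite ?fmorph_eq0 //.
  by rewrite /= au mulrA -rmorphM mulVr // rmorph1 mul1r.
have : m \is a GRing.unit.
  apply/unitrP; exists k; rewrite mulrC; split=> //; apply: (@intr_inj rat);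
  by rewrite mulrC intrM -ma -kb mulrA divfK // divff.
have am : a = m%:~R * b by rewrite -ma divfK.
by case/orP => /eqP mE; rewrite am mE; [left; rewrite mul1r|right; rewrite mulN1r].
Qed.

Lemma local_basis_change (p : primeNat) (L K : zlattice) (E F : 'M[rat]_3)
    (S : 'M[padicNum p]_3) : F \in unitmx ->
  carrier L = zlat E -> carrier K = zlat F ->
  local_carrier p K = linear_image S (local_carrier p L) ->
  exists2 U : 'M[padicInt p]_3, U \in unitmx &
    map_mx (qp p) F = map_mx (@tofrac _) U *m (map_mx (qp p) E *m S).
Proof.
move=> uF LE KF; rewrite (local_carrierE p LE) (local_carrierE p KF) linear_image_lat.
by move=> /(lat_eqP (@tofrac_inj p)) [|U uU EU]; rewrite ?map_unitmx //; exists U.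
Qed.

Lemma similitude_unit (F : fieldType) n (G G' S0 : 'M[F]_n) (a : F) :
  a != 0 -> G' \in unitmx -> S0 *m G *m S0^T = a *: G' -> S0 \in unitmx.
Proof.
move=> a0 uG' S0G; have : a *: G' \in unitmx by rewrite unitmxZ // unitfE.
by rewrite -S0G !unitmx_mul => /andP[/andP[]].
Qed.

(** The same [S0] represents the new pair. At each [p] the inclusion of [M' S0] in [N'] is that of
    [M S0] in [N] moved by [s p]; the two coordinate matrices differ by p-adic unimodular factors,
    so their determinants agree up to sign. *)
Lemma representable_moves (n : nat) (N M N' M' : zlattice) (S0 : 'M[rat]_3) s :
  S0 \in unitmx -> representation (scale n%:R M) N S0 ->
  has_index (carrier N) (linear_image S0 (carrier M)) n ->
  (forall p, s p \in unitmx) ->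
  moves N N' s -> moves M M' (family_conj S0 s) -> representable_pair n N' M'.
Proof.
move=> uS0 [S0B S0sub] ind us [gN' NN'] [gM' MM'].
have [E uE NE] := zlattice_basis N; have [F uF MF] := zlattice_basis M.
have [E' uE' NE'] := zlattice_basis N'; have [F' uF' MF'] := zlattice_basis M'.
have [A FA] : exists A, F *m S0 = map_mx intr A *m E.
  by apply/lat_sub; rewrite -linear_image_lat -MF -NE.
have uSp p : map_mx (qp p) S0 \in unitmx by rewrite map_unitmx.
have loc p : exists U V : 'M[padicInt p]_3, [/\ U \in unitmx, V \in unitmx,
    map_mx (qp p) E' = map_mx (@tofrac _) U *m (map_mx (qp p) E *m s p) &
    map_mx (qp p) (F' *m S0) = map_mx (@tofrac _) V *m
      map_mx (@tofrac _) (map_mx intr A) *m (map_mx (qp p) E *m s p)].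
  have [U uU E'U] := local_basis_change uE' NE NE' (NN' p).
  have [V uV F'V] := local_basis_change uF' MF MF' (MM' p).
  exists U, V; split=> //; rewrite map_mxM F'V /family_conj -!mulmxA.
  rewrite (mulVmx (uSp p)) mulmx1; congr (_ *m _); rewrite !mulmxA.
  by rewrite -(map_mxM (qp p)) FA map_mxM map_intr_qp.
have [A' FA'] : exists A', F' *m S0 = map_mx intr A' *m E'.
  apply: lat_rows => i; apply: zlat_local => // p.
  have [U [V [uU uV E'U FV]]] := loc p.
  rewrite map_row FV; have -> : map_mx (qp p) E *m s p =
      map_mx (@tofrac _) (invmx U) *m map_mx (qp p) E'.
    by rewrite E'U mulmxA -map_mxM mulVmx // map_mx1 mul1mx.
  by rewrite mulmxA -!map_mxM row_mul -map_row; eexists.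
have dA_neq0 (B : 'M[int]_3) (H K : 'M[rat]_3) : H \in unitmx ->
    H *m S0 = map_mx intr B *m K -> \det B != 0.
  move=> uH HB; have : H *m S0 \in unitmx by rewrite unitmx_mul uH.
  rewrite HB unitmx_mul => /andP[+ _].
  by rewrite unitmxE det_map_mx unitfE intr_eq0.
have dA := dA_neq0 A F E uF FA; have dA' := dA_neq0 A' F' E' uF' FA'.
have ind' : has_index (zlat E) (zlat (map_mx intr A *m E)) `|\det A|.
  exact: lattice_index.
have nA : n = `|\det A|%N.
  apply/card_eq_II; apply: card_eq_trans ind'; apply: card_esym.
  by move: ind; rewrite NE MF linear_image_lat FA.
have : (\det A')%:~R = (\det A)%:~R :> rat \/ (\det A')%:~R = - (\det A)%:~R :> rat.
  apply: rat_local_units => [|p]; first by rewrite intr_eq0.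
  have [U [V [uU uV E'U FV]]] := loc p.
  (* Both sides are the coordinates of [F' S0] in the local basis [E s_p]. *)
  have : map_mx (@tofrac _) (map_mx intr A' *m U) =
      map_mx (@tofrac _) (V *m map_mx intr A).
    have uEs : map_mx (qp p) E *m s p \in unitmx.
      by rewrite unitmx_mul map_unitmx uE us.
    apply: (can_inj (mulmxK uEs)).
    by rewrite [in RHS]map_mxM -FV FA' (map_mxM (qp p)) E'U
               map_intr_qp [in LHS]map_mxM -mulmxA.
  move/(congr1 determinant); rewrite !det_map_mx => /tofrac_inj.
  rewrite !det_mulmx !det_map_mx => dAA'.
  exists (\det V * (\det U)^-1).
    by rewrite unitrM unitrV -!unitmxE uV uU.
  rewrite !rmorph_int -!(rmorph_int (@tofrac (padicInt p))) -rmorphM.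
  congr tofrac; rewrite mulrAC -dAA' mulrK // -unitmxE //.
move=> detA'; exists S0; last first.
  have -> : n = `|\det A'|%N.
    rewrite nA; case: detA' => [/intr_inj -> //|].
    by rewrite -rmorphN => /intr_inj ->; rewrite abszN.
  by rewrite NE' MF' linear_image_lat FA'; exact: lattice_index.
split=> [x y|]; first by rewrite /= gN' gM' S0B.
by rewrite /= NE' MF' linear_image_lat; apply/lat_sub; exists A'.
Qed.

(** * Reduction and finiteness *)

Section Reduction.
Local Notation i0 := (@Ordinal 3 0 isT).
Local Notation i1 := (@Ordinal 3 1 isT).
Local Notation i2 := (@Ordinal 3 2 isT).

Lemma sqr_half_le (a x : int) : `|2 * x| <= a -> 4 * (x * x) <= a * a.
Proof.
rewrite ler_norml => /andP[x1 x2].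
have : 0 <= (a - 2 * x) * (a + 2 * x) by rewrite mulr_ge0 //; lia.
by rewrite (_ : _ * _ = a * a - 4 * (x * x)); [lia|ring].
Qed.

(** The Gram matrix has diagonal [a, b, c] and off-diagonal entries [x, y, z]. With [D2 = ab - x^2],
    [E = ac - y^2] and [w = az - xy], the reduction inequalities give [3ab <= 4 D2] and
    [3 D2 E <= 4aD], hence [9bE <= 16D], which bounds [b] and [E]. Then [c <= ac = E + y^2] is
    quadratic in [D]. The constant 100 is generous. *)
Lemma reduced_form_bounds (a x b y z c D : int) :
  0 < a -> 0 < c -> 0 < a * b - x * x ->
  `|2 * x| <= a -> `|2 * y| <= a ->
  `|2 * (a * z - x * y)| <= a * b - x * x ->
  a <= b -> a * b - x * x <= a * c - y * y -> `|2 * z| <= b + c ->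
  D = a * (b * c - z * z) - x * (x * c - y * z) + y * (x * z - b * y) ->
  [/\ `|a| <= 100 * (D * D), `|b| <= 100 * (D * D) & `|c| <= 100 * (D * D)] /\
  [/\ `|x| <= 100 * (D * D), `|y| <= 100 * (D * D) & `|z| <= 100 * (D * D)].
Proof.
move=> a_gt0 c_gt0 D2_gt0 x_le y_le w_le ab D2E z_le DE.
have xx := sqr_half_le x_le; have yy := sqr_half_le y_le.
have ww := sqr_half_le w_le.
have [w wE] : exists w, w = a * z - x * y by eexists.
have [E EE] : exists E, E = a * c - y * y by eexists.
have [D2 D2D] : exists D2, D2 = a * b - x * x by eexists.
(* Sylvester's determinant identity for the minors bordering [a]. *)
have aD : a * D = D2 * E - w * w by rewrite DE D2D EE wE; ring.
rewrite -wE -D2D in ww; rewrite -D2D in D2_gt0 w_le; rewrite -D2D -EE in D2E.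
have aab : 0 <= a * (b - a) by rewrite mulr_ge0 //; lia.
rewrite mulrBr in aab.
have s1 : 3 * (a * b) <= 4 * D2 by rewrite D2D; lia.
have DDE : 0 <= D2 * (E - D2) by rewrite mulr_ge0 //; lia.
rewrite mulrBr in DDE.
have s3 : 3 * (D2 * E) <= 4 * (a * D) by rewrite aD; lia.
have E_gt0 : 0 < E by lia.
have abE : 0 <= E * (4 * D2 - 3 * (a * b)) by rewrite mulr_ge0 //; lia.
have s4 : a * (9 * (b * E)) <= a * (16 * D).
  have -> : a * (9 * (b * E)) = 3 * (E * (3 * (a * b))) by ring.
  have -> : a * (16 * D) = 4 * (4 * (a * D)) by ring.
  have -> : 3 * (E * (3 * (a * b))) =
    12 * (D2 * E) - 3 * (E * (4 * D2 - 3 * (a * b))) by ring.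
  by lia.
rewrite ler_pM2l // in s4.
have b_gt0 : 0 < b by lia.
have bE1 : 0 <= b * (E - 1) by rewrite mulr_ge0 //; lia.
have bE2 : 0 <= (b - 1) * E by rewrite mulr_ge0 //; lia.
rewrite mulrBr mulr1 in bE1; rewrite mulrBl mul1r in bE2.
have b_le : b <= 2 * D by lia.
have E_le : E <= 2 * D by lia.
have D_gt0 : 0 < D by lia.
have DD : 0 <= D * (D - 1) by rewrite mulr_ge0 //; lia.
rewrite mulrBr mulr1 in DD.
have aa : 0 <= (2 * D - a) * (2 * D + a) by rewrite mulr_ge0 //; lia.
rewrite (_ : _ * _ = 4 * (D * D) - a * a) in aa; last ring.
have ac : 0 <= (a - 1) * c by rewrite mulr_ge0 //; lia.
rewrite mulrBl mul1r in ac.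
have c_le : c <= 2 * D + D * D by lia.
clear wE DE aD DDE D2D EE xx yy ww s1 s3 s4 abE bE1 bE2 aa ac aab.
by split; split; lia.
Qed.

Lemma det3 (R : comNzRingType) (A : 'M[R]_3) :
  \det A = A i0 i0 * (A i1 i1 * A i2 i2 - A i1 i2 * A i2 i1)
    - A i0 i1 * (A i1 i0 * A i2 i2 - A i1 i2 * A i2 i0)
    + A i0 i2 * (A i1 i0 * A i2 i1 - A i1 i1 * A i2 i0).
Proof.
have det2 (B : 'M[R]_2) : \det B = B 0 0 * B 1 1 - B 0 1 * B 1 0.
  rewrite (expand_det_row _ 0) !big_ord_recl big_ord0 /cofactor !det_mx11 !mxE /=.
  rewrite (_ : lift 0 0 = 1); last exact/val_inj.
  rewrite (_ : lift 1 0 = 0); last exact/val_inj.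
  by rewrite /bump /= !expr0 !expr1 addr0; ring.
rewrite (expand_det_row _ 0) !big_ord_recl big_ord0 /cofactor !det2 !mxE /=.
rewrite /bump /= !(expr0, expr1) addr0.
have -> : lift ord0 (lift ord0 ord0) = i2 by exact/val_inj.
have -> : lift ord0 ord0 = i1 by exact/val_inj.
have -> : ord0 = i0 by exact/val_inj.
rewrite (_ : 0 = i0); last exact/val_inj.
have -> : lift i0 1 = i2 by exact/val_inj.
have -> : lift i1 0 = i0 by exact/val_inj.
have -> : lift i1 1 = i2 by exact/val_inj.
have -> : lift i2 0 = i0 by exact/val_inj.
have -> : lift i2 1 = i1 by exact/val_inj.
by ring.
Qed.

Lemma round_div (x a : int) : 0 < a -> exists k, `|2 * (x + k * a)| <= a.
Proof.
move=> a_gt0; have e := divz_eq x a.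
have r0 := modz_ge0 x (lt0r_neq0 a_gt0); have r1 := ltz_pmod x a_gt0.
have [small|big] := lerP (2 * (x %% a)%Z) a.
  exists (- (x %/ a)%Z); have -> : x + - (x %/ a)%Z * a = (x %% a)%Z.
    by rewrite {1}e; ring.
  by rewrite ler_norml; lia.
exists (- (x %/ a)%Z - 1); have -> : x + (- (x %/ a)%Z - 1) * a = (x %% a)%Z - a.
  by rewrite {1}e; ring.
by rewrite ler_norml; lia.
Qed.

Lemma addrow_conj (A : 'M[int]_3) (i j : 'I_3) (k : int) : i != j ->
  exists2 V, V \in unitmx & forall p q, (V *m A *m V^T) p q =
    A p q + k *+ (p == i) * A j q + k *+ (q == i) * A p j
      + k *+ (p == i) * k *+ (q == i) * A j j.
Proof.
move=> ij; have delta_mul (B : 'M[int]_3) p q :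
    (delta_mx i j *m B) p q = B j q *+ (p == i).
  rewrite mxE (bigD1 j) //= big1 ?addr0 => [|l lj].
    by rewrite mxE eqxx andbT; case: (p == i); rewrite ?mul1r ?mul0r.
  by rewrite mxE (negbTE lj) andbF mul0r.
pose V k : 'M[int]_3 := 1%:M + k *: delta_mx i j.
exists (V k).
  suff : V k *m V (- k) = 1%:M by case/mulmx1_unit.
  rewrite /V mulmxDl mul1mx mulmxDr mulmx1 -scalemxAl -scalemxAr.
  rewrite mul_delta_mx_cond eq_sym (negbTE ij) mulr0n !scaler0 addr0 scaleNr.
  by rewrite ?addr0 subrK.
have VM (B : 'M[int]_3) p q : (V k *m B) p q = B p q + k * (B j q *+ (p == i)).
  by rewrite /V mulmxDl mul1mx -scalemxAl mxE [X in _ + X]mxE delta_mul.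
have MV (B : 'M[int]_3) p q : (B *m (V k)^T) p q = B p q + k * (B p j *+ (q == i)).
  by rewrite -[in LHS](trmxK B) -trmx_mul mxE VM !mxE.
move=> p q; rewrite MV !VM.
by case: (p == i); case: (q == i); rewrite ?mulr1n ?mulr0n; ring.
Qed.

Lemma swap_conj (A : 'M[int]_3) (i j : 'I_3) :
  exists2 V, V \in unitmx &
    forall p q, (V *m A *m V^T) p q = A (tperm i j p) (tperm i j q).
Proof.
exists (perm_mx (tperm i j)); first exact: unitmx_perm.
by move=> p q; rewrite tr_perm_mx -row_permE -col_permE !mxE.
Qed.

Variable A : 'M[int]_3.
Hypothesis A_sym : A^T = A.
Hypothesis A_pos : forall x : 'rV[int]_3, x != 0 -> 0 < (x *m A *m x^T) 0 0.

Definition congruent (B : 'M[int]_3) := exists2 U, U \in unitmx & B = U *m A *m U^T.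

Lemma congruent_conj B V : V \in unitmx -> congruent B -> congruent (V *m B *m V^T).
Proof.
move=> uV [U uU ->]; exists (V *m U); first by rewrite unitmx_mul uV.
by rewrite trmx_mul !mulmxA.
Qed.

Lemma congruent_sym B p q : congruent B -> B p q = B q p.
Proof.
move=> [U _ ->]; rewrite -[in LHS](trmxK (U *m A *m U^T)) mxE.
by rewrite !trmx_mul trmxK A_sym mulmxA.
Qed.

Lemma congruent_det B : congruent B -> \det B = \det A.
Proof.
move=> [U uU ->]; rewrite !det_mulmx det_tr.
by move: uU; rewrite unitmxE => /orP[]/eqP ->;
   rewrite ?(mul1r, mulr1) ?(mulN1r, mulrN1) ?opprK.
Qed.

Lemma congruent_pos B (u v w : int) : congruent B -> [|| u != 0, v != 0 | w != 0] ->
  0 < u ^+ 2 * B i0 i0 + v ^+ 2 * B i1 i1 + w ^+ 2 * B i2 i2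
    + 2 * u * v * B i0 i1 + 2 * u * w * B i0 i2 + 2 * v * w * B i1 i2.
Proof.
move=> cB uvw; pose x : 'rV[int]_3 := \row_i nth 0 [:: u; v; w] i.
have x0 : x != 0.
  apply: contraTneq uvw => x0; have e i := congr1 (fun y : 'rV_3 => y 0 i) x0.
  by have := (e i0, e i1, e i2); rewrite !mxE /= => -[[-> ->] ->]; rewrite !eqxx.
have xB : 0 < (x *m B *m x^T) 0 0.
  have [U uU ->] := cB; have := A_pos (x := x *m U).
  rewrite trmx_mul !mulmxA; apply; apply: contra x0 => /eqP xU.
  by rewrite -[x](mulmxK uU) xU mul0mx.
move: xB; congr (_ < _).
rewrite mxE !big_ord_recl big_ord0 !mxE !big_ord_recl !big_ord0 !mxE /=.
have -> : lift ord0 (lift ord0 ord0) = i2 by exact/val_inj.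
have -> : lift ord0 ord0 = i1 by exact/val_inj.
have -> : ord0 = i0 by exact/val_inj.
rewrite (congruent_sym i1 i0 cB) (congruent_sym i2 i0 cB) (congruent_sym i2 i1 cB) /=.
by ring.
Qed.

Definition lll_weight (B : 'M[int]_3) : int :=
  B i0 i0 * (B i0 i0 * B i1 i1 - B i0 i1 * B i0 i1).

Lemma congruent_minors B : congruent B ->
  [/\ 0 < B i0 i0, 0 < B i1 i1, 0 < B i2 i2 &
      0 < B i0 i0 * B i1 i1 - B i0 i1 * B i0 i1].
Proof.
move=> cB; have b0 := congruent_pos (u := 1) (v := 0) (w := 0) cB isT.
have b1 := congruent_pos (u := 0) (v := 1) (w := 0) cB isT.
have b2 := congruent_pos (u := 0) (v := 0) (w := 1) cB isT.
have {}b0 : 0 < B i0 i0 by move: b0; congr (0 < _); ring.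
have {}b1 : 0 < B i1 i1 by move: b1; congr (0 < _); ring.
have {}b2 : 0 < B i2 i2 by move: b2; congr (0 < _); ring.
(* In the plane of the first two basis vectors, [(- x, a)] is orthogonal to the first one and takes
   the value [a (ab - x^2)]. *)
split=> //; have := congruent_pos (u := - B i0 i1) (v := B i0 i0) (w := 0) cB.
rewrite (lt0r_neq0 b0) orbT => /(_ isT).
rewrite [X in 0 < X](_ : _ = B i0 i0 * (B i0 i0 * B i1 i1 - B i0 i1 * B i0 i1)).
  by rewrite pmulr_rgt0.
by ring.
Qed.

(** A basis minimising the LLL potential D_1 D_2 (D_k the leading Gram minors)
    satisfies, once size-reduced, the Lovasz conditions with constant 1. *)
Lemma reduction : exists2 B, congruent B &
  forall p q, `|B p q| <= 100 * (\det A * \det A).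
Proof.
have exW : exists k, `[< exists2 B, congruent B & lll_weight B = k%:Z >].
  have cA : congruent A by exists 1%:M; rewrite ?unitmx1 // trmx1 mulmx1 mul1mx.
  have [a0 _ _ D0] := congruent_minors cA.
  exists (absz (lll_weight A)); apply/asboolP; exists A => //.
  by rewrite gez0_abs // /lll_weight mulr_ge0 // ltW.
case: (ex_minnP exW) => W /asboolP[B0 cB0 WB0] Wmin.
have {}Wmin B : congruent B -> W%:Z <= lll_weight B.
  move=> cB; have [a0 _ _ D0] := congruent_minors cB.
  have W0 : 0 <= lll_weight B by rewrite /lll_weight mulr_ge0 // ltW.
  rewrite -(gez0_abs W0) lez_nat; apply: Wmin; apply/asboolP; exists B => //.
  by rewrite gez0_abs.
have [B1 [cB1 WB1 x1]] : exists B, [/\ congruent B, lll_weight B = W &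
    `|2 * B i0 i1| <= B i0 i0].
  have [a0 _ _ _] := congruent_minors cB0.
  have [k kP] := round_div (B0 i0 i1) a0.
  have [V uV VE] := @addrow_conj B0 i1 i0 k isT.
  exists (V *m B0 *m V^T); split; first exact: congruent_conj.
    rewrite -WB0 /lll_weight !VE /= (congruent_sym i1 i0 cB0) ?mulr0n ?mulr1n; ring.
  by rewrite !VE /= ?mulr0n ?mulr1n !mul0r !addr0.
(* Adding [k] times the second vector to the third shifts [w = az - xy] by [k (ab - x^2)] and leaves
   the weight alone. *)
have [B2 [cB2 WB2 x2 w2]] : exists B, [/\ congruent B, lll_weight B = W,
    `|2 * B i0 i1| <= B i0 i0 &
    `|2 * (B i0 i0 * B i1 i2 - B i0 i1 * B i0 i2)| <=
      B i0 i0 * B i1 i1 - B i0 i1 * B i0 i1].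
  have [_ _ _ D0] := congruent_minors cB1.
  have [k kP] := round_div (B1 i0 i0 * B1 i1 i2 - B1 i0 i1 * B1 i0 i2) D0.
  have [V uV VE] := @addrow_conj B1 i2 i1 k isT.
  exists (V *m B1 *m V^T); split; first exact: congruent_conj.
  - by rewrite -WB1 /lll_weight !VE /= ?mulr0n ?mulr1n !mul0r !addr0.
  - by rewrite !VE /= ?mulr0n ?mulr1n !mul0r !addr0.
  rewrite !VE /= ?mulr0n ?mulr1n !mul0r !addr0; move: kP; congr (`|2 * _| <= _); ring.
(* [y] comes last: adding [k] times the first vector to the third changes [y] by [ka] and [z] by
   [kx], so [w] is preserved. *)
have [B [cB WB x_le w_le y_le]] : exists B, [/\ congruent B, lll_weight B = W,
    `|2 * B i0 i1| <= B i0 i0,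
    `|2 * (B i0 i0 * B i1 i2 - B i0 i1 * B i0 i2)| <=
      B i0 i0 * B i1 i1 - B i0 i1 * B i0 i1 & `|2 * B i0 i2| <= B i0 i0].
  have [a0 _ _ _] := congruent_minors cB2.
  have [k kP] := round_div (B2 i0 i2) a0.
  have [V uV VE] := @addrow_conj B2 i2 i0 k isT.
  exists (V *m B2 *m V^T); split; first exact: congruent_conj.
  - by rewrite -WB2 /lll_weight !VE /= ?mulr0n ?mulr1n !mul0r !addr0.
  - by rewrite !VE /= ?mulr0n ?mulr1n !mul0r !addr0.
  - rewrite !VE /= (congruent_sym i1 i0 cB2) ?mulr0n ?mulr1n !mul0r !addr0.
    by move: w2; congr (`|2 * _| <= _); ring.
  by rewrite !VE /= ?mulr0n ?mulr1n !mul0r !addr0.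
have [a0 b0 c0 D0] := congruent_minors cB.
(* Exchanging the first two vectors keeps [D_2] and turns [D_1] from [a] into [b], so minimality
   gives the inequality; for [bc], exchanging the last two keeps [D_1]. *)
have ab : B i0 i0 <= B i1 i1.
  have [V uV VE] := swap_conj B i0 i1.
  have := Wmin _ (congruent_conj uV cB); rewrite -WB /lll_weight !VE.
  rewrite tpermL tpermR (congruent_sym i1 i0 cB).
  by rewrite [B i1 i1 * B i0 i0]mulrC ler_pM2r.
have bc : B i0 i0 * B i1 i1 - B i0 i1 * B i0 i1 <=
    B i0 i0 * B i2 i2 - B i0 i2 * B i0 i2.
  have [V uV VE] := swap_conj B i1 i2.
  have := Wmin _ (congruent_conj uV cB); rewrite -WB /lll_weight !VE.
  by rewrite tpermL (@tpermD _ i1 i2 i0) // ler_pM2l.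
(* Positivity on the sum and the difference of the last two basis vectors. *)
have z_le : `|2 * B i1 i2| <= B i1 i1 + B i2 i2.
  have zp := congruent_pos (u := 0) (v := 1) (w := 1) cB isT.
  have zm := congruent_pos (u := 0) (v := 1) (w := - 1) cB isT.
  rewrite ler_norml; lia.
have [[ha hb hc] [hx hy hz]] := reduced_form_bounds a0 c0 D0 x_le y_le w_le ab bc
  z_le (erefl _).
have dE : B i0 i0 * (B i1 i1 * B i2 i2 - B i1 i2 * B i1 i2)
    - B i0 i1 * (B i0 i1 * B i2 i2 - B i0 i2 * B i1 i2)
    + B i0 i2 * (B i0 i1 * B i1 i2 - B i1 i1 * B i0 i2) = \det A.
  rewrite -(congruent_det cB) det3 (congruent_sym i1 i0 cB).
  by rewrite (congruent_sym i2 i0 cB) (congruent_sym i2 i1 cB); ring.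
rewrite dE in ha hb hc hx hy hz; exists B => //.
have ordP (p : 'I_3) : [\/ p = i0, p = i1 | p = i2].
  case: p => [[|[|[|//]]] hp]; [exact: Or31 (val_inj _)|
    exact: Or32 (val_inj _)|exact: Or33 (val_inj _)].
move=> p q; case: (ordP p) => ->; case: (ordP q) => -> //;
  by rewrite congruent_sym.
Qed.

End Reduction.

Lemma isometry_gram (F : fieldType) n (U E S G : 'M[F]_n) : S *m G *m S^T = G ->
  U *m (E *m S) *m G *m (U *m (E *m S))^T = U *m (E *m G *m E^T) *m U^T.
Proof. by move=> SG; rewrite -[in RHS]SG !trmx_mul !mulmxA. Qed.

(** A proper global isometry is itself the rational rotation, with trivial local parts; an improper
    one is replaced by its negative, which has the same image lattice. *)
Lemma psg_isometric (G : 'M[rat]_3) (K K1 : zlattice) (S : 'M[rat]_3) :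
  G^T = G -> positive_form G -> gram K = G -> gram K1 = G ->
  S *m G *m S^T = G -> carrier K1 = linear_image S (carrier K) ->
  proper_spinor_genus K K1.
Proof.
move=> G_sym G_pos gK gK1 SG.
wlog dS : S SG / \det S = 1 => [hw|].
  have [dS|dS] := isometry_det (qform_unit G_sym G_pos) SG; first exact: hw.
  move=> K1S; apply: (hw (- S)); first exact: isometry_opp.
    by rewrite det_opp dS -signr_odd mulrNN mulr1.
  have [E uE KE] := zlattice_basis K.
  rewrite K1S KE !linear_image_lat; apply/seteqP.
  by split=> _ [c _ <-]; exists (- c); rewrite // map_mxN mulmxN mulNmx ?mulmxN ?opprK.
move=> K1S; have SO : special_orthogonal_group G S by apply/special_orthogonalP.
have uS := special_orthogonal_unit SO.
apply: (@psgI G K K1 S (fun p => map_mx (qp p) S)) => //.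
  split=> [|p]; first by rewrite gK1.
  have [E uE KE] := zlattice_basis K.
  rewrite (local_carrierE p KE) linear_image_lat -(map_mxM (qp p)).
  by apply: local_carrierE; rewrite K1S KE linear_image_lat.
by move=> p; rewrite mulmxV ?map_unitmx //; exact: spinor_kernel1.
Qed.

Lemma finite_bounded_matrices (b : nat) :
  finite_set [set C : 'M[int]_3 | forall p q, `|C p q| <= b%:Z].
Proof.
pose f (X : 'M['I_(b + b).+1]_3) : 'M[int]_3 := 
    map_mx (fun i : 'I_(b + b).+1 => (i : nat)%:Z - b%:Z) X.
apply: (@sub_finite_set _ _ (f @` [set: _])); last exact/finite_image/finite_finset.
move=> C Cb; exists (\matrix_(p, q) inord `|(C p q + b%:Z)%R|%N) => //.
apply/matrixP => p q; rewrite !mxE inordK; have := Cb p q; rewrite ler_norml; lia.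
Qed.

(** * Finiteness of the number of spinor genera *)

Section Finiteness.
Variable N : zlattice.
Hypothesis N_pos : positive_form (gram N).
Let G := gram N.

(** Locally the Gram matrices are [U A0 U^T] with [U] unimodular, so one denominator [d] serves the
    whole genus. Comparison up to local units leaves a sign, which squaring the determinant
    removes. *)
Lemma genus_gram_integral (E : 'M[rat]_3) (d : nat) (A0 : 'M[int]_3) (K : zlattice)
    (F : 'M[rat]_3) :
  E \in unitmx -> carrier N = zlat E -> (0 < d)%N ->
  d%:R *: (E *m G *m E^T) = map_mx intr A0 ->
  genus N K -> F \in unitmx -> carrier K = zlat F ->
  exists2 A : 'M[int]_3, d%:R *: (F *m G *m F^T) = map_mx intr A &
    \det A * \det A = \det A0 * \det A0.
Proof.
move=> uE NE d_gt0 EA0 gNK uF KF.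
have [s [sO _] [gK NK]] := genus_moves N_pos gNK.
have loc p : exists2 U : 'M[padicInt p]_3, U \in unitmx &
    map_mx (qp p) (d%:R *: (F *m G *m F^T)) =
    map_mx (@tofrac _) (U *m map_mx intr A0 *m U^T).
  have [U uU FU] := local_basis_change uF NE KF (NK p).
  exists U => //; have [sG _] := (special_orthogonalP _ _).1 (sO p).
  rewrite map_mxZ rmorph_nat !(map_mxM (qp p)) -(map_trmx (qp p)) FU.
  rewrite (isometry_gram _ _ sG) !(map_mxM (@tofrac _)) -map_trmx -map_intr_qp.
  rewrite -EA0 map_mxZ rmorph_nat !(map_mxM (qp p)) -(map_trmx (qp p)).
  by rewrite -scalemxAr -scalemxAl.
have Aint (pq : 'I_3 * 'I_3) : exists m : int,
    (d%:R *: (F *m G *m F^T)) pq.1 pq.2 = m%:~R.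
  apply: rat_integral => p; have [U uU /matrixP/(_ pq.1 pq.2)] := loc p.
  by rewrite mxE => ->; rewrite mxE; eexists.
have [A AP] := choice Aint.
have FA : d%:R *: (F *m G *m F^T) = map_mx intr (\matrix_(i, j) A (i, j)).
  by apply/matrixP => i j; rewrite (AP (i, j)) !mxE.
have dA0 : (\det A0)%:~R != 0 :> rat.
  rewrite -(det_map_mx intr) -EA0 -unitfE -unitmxE unitmxZ ?unitfE ?pnatr_eq0 -?lt0n //.
  by rewrite !unitmx_mul unitmx_tr uE (qform_unit (gram_sym N) N_pos).
exists (\matrix_(i, j) A (i, j)) => //.
have : (\det (\matrix_(i, j) A (i, j)))%:~R = (\det A0)%:~R :> rat \/
    (\det (\matrix_(i, j) A (i, j)))%:~R = - (\det A0)%:~R :> rat.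
  apply: rat_local_units => // p; have [U uU] := loc p.
  rewrite FA map_intr_qp => /(congr1 determinant); rewrite !det_map_mx => /tofrac_inj.
  rewrite !det_mulmx det_tr !det_map_mx => dA.
  exists (\det U * \det U); first by rewrite unitrM -!unitmxE uU.
  rewrite !rmorph_int -!(rmorph_int (@tofrac (padicInt p))) dA -rmorphM.
  by congr tofrac; rewrite mulrAC.
case=> [/intr_inj -> //|]; rewrite -rmorphN => /intr_inj ->.
by rewrite mulrNN.
Qed.

Lemma finite_spinor_genera : finite_set (proper_spinor_genera N).
Proof.
have [E uE NE] := zlattice_basis N.
have [d d_gt0 [A0 EA0]] := common_denominator (E *m G *m E^T).
have d0 : d%:R != 0 :> rat by rewrite pnatr_eq0 -lt0n.
pose b := absz (100 * (\det A0 * \det A0)).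
pose has_gram C K := gram K = G /\ exists F, [/\ F \in unitmx, carrier K = zlat F &
  d%:R *: (F *m G *m F^T) = map_mx (intr : int -> rat) C].
(* Lattices on one space with equal Gram matrices are isometric, so [g C] is a single spinor genus
   whenever [C] is realised, and empty otherwise. *)
pose g (C : 'M[int]_3) : set zlattice :=
  [set K' | exists2 K, has_gram C K & proper_spinor_genus K K'].
apply: (@sub_finite_set _ _
  (g @` [set C : 'M[int]_3 | forall p q, `|C p q| <= b%:Z])); last first.
  exact/finite_image/finite_bounded_matrices.
move=> _ [K gNK <-]; have gK : gram K = G by case: gNK.
have [F uF KF] := zlattice_basis K.
have [A FA dA] := genus_gram_integral uE NE d_gt0 EA0 gNK uF KF.
have A_sym : A^T = A.
  have : map_mx (intr : int -> rat) A^T = map_mx intr A.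
    rewrite -map_trmx -FA linearZ /= !trmx_mul trmxK /G gram_sym mulmxA //.
  by move/matrixP => h; apply/matrixP => i j; have := h i j; rewrite !mxE => /intr_inj.
have A_pos (x : 'rV[int]_3) : x != 0 -> 0 < (x *m A *m x^T) 0 0.
  move=> x0; rewrite -(ltr_int rat).
  have -> : ((x *m A *m x^T) 0 0)%:~R =
      d%:R * qform G (map_mx (intr : int -> rat) x *m F).
    transitivity ((map_mx (intr : int -> rat) (x *m A *m x^T)) 0 0).
      by rewrite [in RHS]mxE.
    rewrite !map_mxM -FA -map_trmx -scalemxAr -scalemxAl mxE /qform /bform.
    by rewrite trmx_mul !mulmxA.
  rewrite mulr_gt0 ?ltr0n //; apply: N_pos.
  apply: contra x0 => /eqP xF; apply/eqP/rowP => i.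
  have : map_mx (intr : int -> rat) x = 0 by rewrite -[LHS](mulmxK uF) xF mul0mx.
  by move=> /rowP/(_ i); rewrite !mxE => /eqP; rewrite intr_eq0 => /eqP.
have [C [U uU CU] C_le] := reduction A_sym A_pos.
exists C.
  by move=> p q; rewrite (le_trans (C_le p q)) // dA /b; lia.
have KC : has_gram C K.
  split=> //; exists (map_mx intr U *m F); split.
  - by rewrite unitmx_mul map_mx_unit.
  - by rewrite KF; apply/esym/(lat_eqP intr_inj);
       [rewrite unitmx_mul map_mx_unit|exists U].
  by rewrite CU !map_mxM -FA -map_trmx trmx_mul -scalemxAr -scalemxAl !mulmxA.
apply/seteqP; split=> [K' [K1 [gK1 [F1 [uF1 K1F1 F1C]]] K1K']|K' KK']; last by exists K.
apply: (psg_trans (gram_sym N) N_pos gK _ K1K').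
have [_ [F' [uF' KF' F'C]]] := KC.
have FF : F1 *m G *m F1^T = F' *m G *m F'^T.
  by apply: (scalerI d0); rewrite F1C F'C.
apply: (@psg_isometric G _ _ (invmx F' *m F1)) => //; first exact: gram_sym.
  rewrite trmx_mul trmx_inv !mulmxA -(mulmxA _ F1) -(mulmxA _ (F1 *m G)) FF.
  by rewrite !mulmxA mulVmx // mul1mx mulmxK ?unitmx_tr.
by rewrite K1F1 KF' linear_image_lat mulmxA mulmxV // mul1mx.
Qed.

End Finiteness.

(** * Matching *)

Section HeapMatching.
Variables (T : Type) (X : set T) (m : T -> T -> T -> T) (g : nat).
Hypothesis mX : forall x y z, X x -> X y -> X z -> X (m x y z).
Hypothesis mK : forall x y z, X x -> X y -> X z -> m (m x y z) z y = x.

(** Abstracts the label of a coset of a subgroup containing all commutators: equal labels cancel on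
    either side of [x y^-1 z], and translation respects labels. *)
Definition heap_invariant (c : T -> 'I_g) : Prop :=
  [/\ forall i, exists2 x, X x & c x = i,
      forall x y z, X x -> X y -> X z -> c x = c y -> c (m x y z) = c z,
      forall x y z, X x -> X y -> X z -> c y = c z -> c (m x y z) = c x &
      forall a b y z, X a -> X b -> X y -> X z -> c a = c b ->
        c (m a y z) = c (m b y z)].

Definition meet (c1 c2 : T -> 'I_g) i j : bool :=
  `[< exists x, [/\ X x, c1 x = i & c2 x = j] >].

(** Translation by [x^-1 x'] takes the [c1]-class [i] to [i']; it is injective on [c2]-classes
    because translating back recovers them, so neighbours of [i] inject into neighbours of [i']. *)
Lemma meet_degree_le c1 c2 : heap_invariant c1 -> heap_invariant c2 ->
  forall i i', (#|[set j | meet c1 c2 i j]%SET| <= #|[set j | meet c1 c2 i' j]%SET|)%N.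
Proof.
move=> [surj1 L1 _ _] [_ _ _ T2] i i'.
have [x Xx xi] := surj1 i; have [x' Xx' xi'] := surj1 i'.
(* [y j] witnesses the edge from [i] to [j]; for non-neighbours [x] is a dummy value. *)
have yP j : exists y, X y /\ (meet c1 c2 i j -> c1 y = i /\ c2 y = j).
  have [/asboolP[y [Xy yi yj]]|nij] := boolP (meet c1 c2 i j).
    by exists y; split=> // _.
  by exists x; split=> // ij; rewrite ij in nij.
have [y {}yP] := choice yP; pose h j := c2 (m (y j) x x').
rewrite -(@card_in_imset _ _ h) => [|j j']; last first.
  rewrite !finset.in_set => ij ij' hjj'.
  have [[Xj /(_ ij)[_ <-]] [Xj' /(_ ij')[_ <-]]] := (yP j, yP j').
  rewrite -(mK Xj Xx Xx') -[in RHS](mK Xj' Xx Xx').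
  by apply: T2 => //; exact: mX.
apply/subset_leq_card/fintype.subsetP => _ /imsetP[j ij ->].
move: ij; rewrite !finset.in_set => ij.
have [Xj /(_ ij)[ji _]] := yP j; apply/asboolP; exists (m (y j) x x').
by split=> //; [exact: mX|rewrite L1 // ji xi].
Qed.

(** The graph [meet c1 c2] is a disjoint union of complete bipartite graphs,
    and it is biregular; with both sides of size [g] the parts are balanced. *)
Lemma heap_matching c1 c2 : heap_invariant c1 -> heap_invariant c2 ->
  exists2 f : 'I_g -> 'I_g, injective f &
    forall i, exists x, [/\ X x, c1 x = i & c2 x = f i].
Proof.
move=> inv1 inv2; pose Rs i := [set j | meet c1 c2 i j]%SET.
pose Ls j := [set i | meet c1 c2 i j]%SET.
have LsE j : Ls j = [set i | meet c2 c1 j i]%SET.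
  by apply/finset.setP => i; rewrite !finset.in_set;
     apply: asbool_equiv_eq; split=> -[x []];
     exists x.
(* For witnesses [x, y, z] of the three edges, [x y^-1 z] witnesses the fourth: every connected
   component is complete bipartite. *)
have difun i i' j j' : meet c1 c2 i j -> meet c1 c2 i' j -> meet c1 c2 i' j' ->
    meet c1 c2 i j'.
  move=> /asboolP[x [Xx xi xj]] /asboolP[y [Xy yi yj]] /asboolP[z [Xz zi zj]].
  apply/asboolP; exists (m x y z); split; first exact: mX.
    by case: inv1 => _ _ R1 _; rewrite R1 // yi zi.
  by case: inv2 => _ L2 _ _; rewrite L2 // xj yj.
have degR i i' : #|Rs i| = #|Rs i'|.
  by apply/eqP; rewrite eqn_leq !meet_degree_le.
have degL j j' : #|Ls j| = #|Ls j'|.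
  by apply/eqP; rewrite eqn_leq !LsE !meet_degree_le.
(* Count the edges from both sides: there are [g] vertices on each, so the two constant degrees
   coincide. *)
have deg i j : #|Rs i| = #|Ls j|.
  have g_gt0 : (0 < g)%N by case: (g) i => // -[].
  apply/eqP; rewrite -(eqn_pmul2l g_gt0); apply/eqP.
  have <- : (\sum_(k < g) #|Rs k| = g * #|Rs i|)%N.
    by rewrite (eq_bigr (fun=> #|Rs i|)) // sum_nat_const card_ord.
  have <- : (\sum_(k < g) #|Ls k| = g * #|Ls j|)%N.
    by rewrite (eq_bigr (fun=> #|Ls j|)) // sum_nat_const card_ord.
  have cardE (B : {set 'I_g}) : #|B| = (\sum_k (k \in B))%N.
    by rewrite -sum1_card big_mkcond; apply: eq_bigr => k _; case: (k \in B).
  under [LHS]eq_bigr do rewrite cardE.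
  under [RHS]eq_bigr do rewrite cardE.
  rewrite exchange_big; apply: eq_bigr => k _; apply: eq_bigr => l _.
  by rewrite !finset.in_set.
have Rs_ex i : exists j, j \in Rs i.
  have [[surj1 _ _ _] _] := (inv1, inv2); have [x Xx xi] := surj1 i.
  by exists (c2 x); rewrite finset.in_set; apply/asboolP; exists x.
have RsE i i' j : j \in Rs i -> j \in Rs i' -> Rs i = Rs i'.
  rewrite !finset.in_set => ij i'j; apply/finset.setP => l; rewrite !finset.in_set.
  by apply/idP/idP => [h|h]; [exact: difun i'j ij h|exact: difun ij i'j h].
(* The left half of the component of [i], as [Rs i] is its right half. *)
pose S i := [set i' | Rs i' == Rs i]%SET.
have cardS i : #|S i| = #|Rs i|.
  have [j ij] := Rs_ex i; rewrite (deg i j); congr #|pred_of_set _|.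
  apply/finset.setP => i'; rewrite !finset.in_set; apply/eqP/idP => [RR|i'j].
    by move: ij; rewrite -RR finset.in_set.
  by apply: (RsE _ _ j); rewrite ?finset.in_set // -?finset.in_set.
(* Match equal positions in the enumerations of the two halves; [idx] shows that the default [i] is
   never reached. *)
pose f i := nth i (enum (Rs i)) (index i (enum (S i))).
have idx i : (index i (enum (S i)) < size (enum (Rs i)))%N.
  by rewrite -cardE -cardS cardE index_mem mem_enum finset.in_set.
have fR i : f i \in Rs i by rewrite -mem_enum mem_nth.
exists f => [i i' ff|i]; last first.
  by have := fR i; rewrite finset.in_set => /asboolP[x]; exists x.
have RR : Rs i = Rs i' by apply: (RsE _ _ (f i)) => //; rewrite ff.
have SS : S i = S i' by apply/finset.setP => k; rewrite !finset.in_set RR.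
have := idx i'; move: ff; rewrite /f -RR -SS => + idx'.
rewrite (set_nth_default i') // => /eqP; rewrite nth_uniq ?enum_uniq //.
move=> /eqP eq_idx.
have [iS i'S] : i \in enum (S i) /\ i' \in enum (S i).
  by rewrite !mem_enum !finset.in_set RR.
by rewrite -(nth_index i iS) eq_idx nth_index.
Qed.

End HeapMatching.

(** * Similitudes and the correspondence *)

Section Conjugation.
Variables (F : fieldType) (n : nat).
Implicit Types C S T : 'M[F]_n.

Lemma mulmx_conjK C S : C \in unitmx ->
  C *m (invmx C *m S *m invmx (invmx C)) *m invmx C = S.
Proof. by move=> uC; rewrite invmxK !mulmxA (mulmxV uC) mul1mx (mulmxK uC). Qed.

Lemma mulmx_conjM C S T : C \in unitmx ->
  C *m (S *m T) *m invmx C = (C *m S *m invmx C) *m (C *m T *m invmx C).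
Proof. by move=> uC; rewrite !mulmxA (mulmxKV uC). Qed.

Lemma invmx_conj C S : C \in unitmx -> S \in unitmx ->
  invmx (C *m S *m invmx C) = C *m invmx S *m invmx C.
Proof.
move=> uC uS; rewrite invmxM ?unitmx_inv ?unitmx_mul ?uC //.
by rewrite invmxM // invmxK mulmxA.
Qed.

Lemma mulmx_conj_heap C S T U : C \in unitmx -> T \in unitmx ->
  C *m (S *m invmx T *m U) *m invmx C =
  (C *m S *m invmx C) *m invmx (C *m T *m invmx C) *m (C *m U *m invmx C).
Proof. by move=> uC uT; rewrite invmx_conj // !mulmx_conjM. Qed.

End Conjugation.

Section Similitude.
Variables (L K : zlattice) (S0 : 'M[rat]_3) (a : rat).
Hypothesis a_neq0 : a != 0.
Hypothesis S0_unit : S0 \in unitmx.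
Hypothesis S0_sim : S0 *m gram L *m S0^T = a *: gram K.
Local Notation conj := (family_conj S0).
Local Notation S0p p := (map_mx (qp p) S0).

Lemma local_similitude p :
  S0p p *m map_mx (qp p) (gram L) *m (S0p p)^T = qp p a *: map_mx (qp p) (gram K).
Proof. by rewrite map_trmx -!map_mxM S0_sim map_mxZ. Qed.

Lemma SO_family_conj s : SO_family (gram L) s -> SO_family (gram K) (conj s).
Proof.
move=> sO p; apply: (special_orthogonal_similitude _ _ (local_similitude p) (sO p)).
  by rewrite fmorph_eq0.
by rewrite map_unitmx.
Qed.

(** Carry [K1] by [S0], transport the result along [s], and return by the inverse of [S0]. *)
Lemma moves_conj_exists L1 L2 K1 s : moves L1 L2 s -> exists K2, moves K1 K2 (conj s).
Proof.
move=> [_ L12]; have [P [_ _ PK1]] := image_lattice K1 (gram_sym K1) S0_unit.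
have [P' [_ PP']] := transport_lattice P L12.
have uV : invmx S0 \in unitmx by rewrite unitmx_inv.
have [K2 [gK2 _ K2P']] := image_lattice P' (gram_sym K1) uV.
exists K2; split=> // p; rewrite K2P' PP' PK1 !linear_imageM map_invmx.
by rewrite /family_conj mulmxA.
Qed.

Lemma admissible_conj s : admissible L s -> admissible K (conj s).
Proof.
move=> [sO [L' mLL']]; split; first exact: SO_family_conj.
exact: moves_conj_exists mLL'.
Qed.

(** Lifts a step inside a spinor genus through the similitude. [t] is a kernel family times a
    rational rotation, and conjugation sends each factor to one of the same kind; this passes from
    matched spinor genera to individual lattices. *)
Lemma psg_conj L1 L2 : gram L1 = gram L -> proper_spinor_genus L1 L2 ->
  exists t, [/\ SO_family (gram L) t, moves L1 L2 t &
    forall K1 K2, gram K1 = gram K -> moves K1 K2 (conj t) ->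
      proper_spinor_genus K1 K2].
Proof.
move=> gL1 L12; have [T [s [TO sT mL12]]] := psgE gL1 L12.
exists (fun p => s p *m map_mx (qp p) T); split=> // [p|K1 K2 gK1 mK12].
  apply: special_orthogonalM; first exact: spinor_kernel_special (sT p).
  exact: local_special_orthogonal TO.
have uSp p : S0p p \in unitmx by rewrite map_unitmx.
have T'O := special_orthogonal_similitude a_neq0 S0_unit S0_sim TO.
apply: (psgI gK1 T'O mK12) => p.
rewrite /family_conj (mulmx_conjM _ _ (uSp p)) !map_mxM map_invmx.
rewrite mulmxK; last first.
  by rewrite !unitmx_mul unitmx_inv uSp map_unitmx (special_orthogonal_unit TO).
apply: (spinor_kernel_similitude _ _ _ (local_similitude p) (sT p)).
- exact: padicNum_two_neq0.
- by rewrite fmorph_eq0.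
- exact: uSp.
Qed.

End Similitude.

Lemma family_conjK S0 s : S0 \in unitmx ->
  family_conj S0 (family_conj (invmx S0) s) = s.
Proof.
move=> uS0; apply: functional_extensionality_dep => p.
by rewrite /family_conj map_invmx mulmx_conjK // map_unitmx.
Qed.

Lemma family_conj_heap (S0 : 'M[rat]_3) (x y z : family) : S0 \in unitmx ->
  (forall p, y p \in unitmx) ->
  family_conj S0 (family_heap x y z) =
  family_heap (family_conj S0 x) (family_conj S0 y) (family_conj S0 z).
Proof.
move=> uS0 uy; apply: functional_extensionality_dep => p.
have uSp : map_mx (qp p) S0 \in unitmx by rewrite map_unitmx.
exact: mulmx_conj_heap uSp (uy p).
Qed.

Lemma family_conjM (S0 : 'M[rat]_3) (x y : family) : S0 \in unitmx ->
  family_conj S0 (fun p => x p *m y p) =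
  (fun p => family_conj S0 x p *m family_conj S0 y p).
Proof.
move=> uS0; apply: functional_extensionality_dep => p.
by rewrite /family_conj mulmx_conjM // map_unitmx.
Qed.

(** * Isometry classes and labels of spinor genera *)

Lemma isometric_refl L : isometric L L.
Proof.
exists 1%:M; last exact: linear_image1.
split; last exact: unitmx1.
by split=> [x y|]; rewrite ?mulmx1 // linear_image1.
Qed.

Lemma isometry_class_eq L K : isometry_class L = isometry_class K -> isometric L K.
Proof. by move=> LK; have : isometry_class K K := isometric_refl K; rewrite -LK. Qed.

Lemma linear_image_inj (F : fieldType) (S : 'M[F]_3) : S \in unitmx ->
  injective (linear_image S).
Proof.
by move=> uS A B AB; rewrite (linear_imageK uS AB) linear_imageM mulmxV // linear_image1.
Qed.

Lemma index_linear_image (A B : set 'rV[rat]_3) (S : 'M[rat]_3) n : S \in unitmx ->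
  has_index A B n -> has_index (linear_image S A) (linear_image S B) n.
Proof.
move=> uS; apply: card_eq_trans.
have -> : cosets (linear_image S A) (linear_image S B) =
    linear_image S @` cosets A B.
  have imD x : [set x *m S + z | z in linear_image S B] =
      linear_image S [set x + z | z in B].
    apply/seteqP; split=> [_ [_ [z Bz <-] <-]|_ [_ [z Bz <-] <-]].
      by exists (x + z); [exists z|rewrite mulmxDl].
    by exists (z *m S); [exists z|rewrite mulmxDl].
  apply/seteqP; split=> [_ [_ [x Ax <-] <-]|_ [_ [x Ax <-] <-]].
    by rewrite imD; eexists => //; exists x.
  by rewrite -imD; exists (x *m S) => //; exists x.
by apply: inj_card_eq => C C' _ _; exact: linear_image_inj.
Qed.

(** A correspondence is a set of pairs of classes, so representability has to hold for all
    representatives at once. *)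
Lemma representable_isometric n N M N' M' : isometric N N' -> isometric M M' ->
  representable_pair n N M -> representable_pair n N' M'.
Proof.
move=> [P [[PB _] uP] PN] [R [[RB _] uR] RM] [S [SB SM] ind].
have M'M : linear_image (invmx R *m S *m P) (carrier M') =
    linear_image P (linear_image S (carrier M)).
  by rewrite -RM !linear_imageM !mulmxA mulmxV // mul1mx.
exists (invmx R *m S *m P); last by rewrite M'M -PN; exact: index_linear_image.
split=> [x y|].
  rewrite !mulmxA PB SB /= -[x in RHS](mulmxKV uR) -[y in RHS](mulmxKV uR).
  have bZ (G : 'M[rat]_3) u v : bform (n%:R *: G) u v = n%:R * bform G u v.
    by rewrite /bform -scalemxAr -scalemxAl mxE.
  by rewrite !bZ RB.
rewrite /= M'M -PN => _ [x Sx <-]; exists x => //; exact: SM.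
Qed.

(** Pulls the labels of spinor genera in gen(M) back to the families acting on [N], so that both
    labellings live on one set. *)
Lemma heap_invariant_comp (T T' : Type) (X : set T) (X' : set T') m m' g
    (phi : T -> T') (c : T' -> 'I_g) :
  (forall x, X x -> X' (phi x)) -> (forall t, X' t -> exists2 x, X x & phi x = t) ->
  (forall x y z, X x -> X y -> X z -> phi (m x y z) = m' (phi x) (phi y) (phi z)) ->
  heap_invariant X' m' c -> heap_invariant X m (c \o phi).
Proof.
move=> phiX phi_surj phiM [surj Lc Rc Tc].
split=> [i|x y z ? ? ?|x y z ? ? ?|a b y z ? ? ? ?] /=.
- by have [t /phi_surj[x Xx <-] ti] := surj i; exists x.
- by rewrite phiM //; apply: Lc; exact: phiX.
- by rewrite phiM //; apply: Rc; exact: phiX.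
- by rewrite !phiM //; apply: Tc; exact: phiX.
Qed.

Lemma spinor_genera_label (L : zlattice) n : proper_spinor_genera L #= `I_n.+1 ->
  exists k : set zlattice -> 'I_n.+1,
    (forall K1 K2, genus L K1 -> genus L K2 ->
      k (proper_spinor_genus K1) = k (proper_spinor_genus K2) ->
      proper_spinor_genus K1 = proper_spinor_genus K2) /\
    forall i, exists2 K, genus L K & k (proper_spinor_genus K) = i.
Proof.
move=> /card_set_bijP[e [e_lt e_inj e_surj]].
have in_genera K : genus L K -> proper_spinor_genera L (proper_spinor_genus K).
  by move=> gK; exists K.
exists (fun A => inord (e A)); split=> [K1 K2 g1 g2 e12|i].
  apply: e_inj; rewrite ?inE; [exact: in_genera..|].
  have := congr1 (fun i : 'I_n.+1 => val i) e12.
  by rewrite /= !inordK //; apply/e_lt/in_genera.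
have [_ [K gK <-] eK] := e_surj i (ltn_ord i).
by exists K => //; apply/val_inj; rewrite /= eK inordK.
Qed.

Lemma family_class_heap_invariant (L : zlattice) n (k : set zlattice -> 'I_n) :
  positive_form (gram L) ->
  (forall K1 K2, genus L K1 -> genus L K2 ->
    k (proper_spinor_genus K1) = k (proper_spinor_genus K2) ->
    proper_spinor_genus K1 = proper_spinor_genus K2) ->
  (forall i, exists2 K, genus L K & k (proper_spinor_genus K) = i) ->
  heap_invariant (admissible L) family_heap (k \o family_class L).
Proof.
move=> L_pos k_inj k_surj.
have kE x y : admissible L x -> admissible L y ->
    k (family_class L x) = k (family_class L y) -> family_class L x = family_class L y.
  move=> [xO [K1 m1]] [yO [K2 m2]].
  rewrite (family_classE L_pos xO m1) (family_classE L_pos yO m2).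
  by apply: k_inj; [exact: moves_genus xO m1|exact: moves_genus yO m2].
split=> [i|x y z xA yA zA|x y z xA yA zA|a b y z aA bA yA zA] /=.
- have [K gK <-] := k_surj i; have [s sA mLK] := genus_moves L_pos gK.
  by exists s => //; rewrite (family_classE L_pos sA.1 mLK).
- by move=> /(kE _ _ xA yA) xy; rewrite family_class_heapl.
- by move=> /(kE _ _ yA zA) yz; rewrite family_class_heapr.
- by move=> /(kE _ _ aA bA) ab; congr k; exact: family_class_transl.
Qed.

Lemma psg_isometry_class (L K1 K2 : zlattice) : positive_form (gram L) ->
  genus L K1 -> genus L K2 -> isometry_class K1 = isometry_class K2 ->
  proper_spinor_genus K1 = proper_spinor_genus K2.
Proof.
move=> L_pos [g1 _] [g2 _] /isometry_class_eq[S [[SB _] uS] SK].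
apply/(psg_eqP (gram_sym L) L_pos g1 g2).
apply: (psg_isometric (gram_sym L) L_pos g1 g2 _ (esym SK)).
by apply/isometryP => x y; have := SB x y; rewrite g1 g2.
Qed.

Theorem theorem4p4 (n : nat) (N M : zlattice)
  (n_gt0 : (0 < n)%N)
  (N_posdef : positive_definite N) (M_posdef : positive_definite M)
  (N_integral : nonclassic_integral N) (M_integral : nonclassic_integral M)
  (NM_representable : representable_pair n N M)
  (gN_eq_gM : proper_spinor_genera N #= proper_spinor_genera M) :
  exists C : set (set zlattice * set zlattice),
    genus_correspondence n N M C /\ respects_spinor_genus N M C.
Proof.
have [S0 [S0B S0sub] ind] := NM_representable.
have n0 : n%:R != 0 :> rat by rewrite pnatr_eq0 -lt0n.
have S0_sim : S0 *m gram N *m S0^T = n%:R *: gram M.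
  apply/matrixP => i j; have := S0B (delta_mx 0 i) (delta_mx 0 j).
  rewrite /bform trmx_mul !mulmxA -(mulmxA _ S0) -(mulmxA _ (S0 *m _)).
  by rewrite -!rowE trmx_delta -!colE !mxE.
have uS0 : S0 \in unitmx.
  by apply: similitude_unit S0_sim => //; exact: qform_unit (gram_sym M) M_posdef.
have uS0V : invmx S0 \in unitmx by rewrite unitmx_inv.
have n0V : n%:R^-1 != 0 :> rat by rewrite invr_eq0.
have S0V_sim : invmx S0 *m gram M *m (invmx S0)^T = n%:R^-1 *: gram N.
  have -> : gram M = n%:R^-1 *: (S0 *m gram N *m S0^T).
    by rewrite S0_sim scalerA mulVf // scale1r.
  rewrite -scalemxAr -scalemxAl !mulmxA mulVmx // mul1mx trmx_inv.
  by rewrite mulmxK ?unitmx_tr.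
(* The genus contains [N], so the number of spinor genera is positive and labels can be taken in
   ['I_g.+1]. *)
have [g gN gM] : exists2 g, proper_spinor_genera N #= `I_g.+1 &
    proper_spinor_genera M #= `I_g.+1.
  have [[|g] gN] := finite_spinor_genera N_posdef.
    move: gN; rewrite II0 card_eq0 => /eqP gN0.
    suff : set0 (proper_spinor_genus N) by [].
    by rewrite -gN0; exists N => //; split=> // p; exists 1%:M;
       [have [] := special_orthogonal1 (local_gram p N)|rewrite linear_image1].
  by exists g => //; apply: card_eq_trans gN; exact: card_esym.
have [k1 [k1_inj k1_surj]] := spinor_genera_label gN.
have [k2 [k2_inj k2_surj]] := spinor_genera_label gM.
have inv1 := family_class_heap_invariant N_posdef k1_inj k1_surj.
have inv2 : heap_invariant (admissible N) family_heap
    ((k2 \o family_class M) \o family_conj S0).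
  apply: heap_invariant_comp (family_class_heap_invariant M_posdef k2_inj k2_surj).
  - exact: admissible_conj n0 uS0 S0_sim.
  - move=> t tA; exists (family_conj (invmx S0) t); last exact: family_conjK.
    exact: admissible_conj n0V uS0V S0V_sim _ tA.
  - by move=> x y z xA [yO _] zA; apply: family_conj_heap => // p;
       exact: SO_family_unit yO.
have [f f_inj f_meet] := heap_matching (admissible_heap (L := N))
  (fun x y z xA yA zA => heapK x yA.1 zA.1) inv1 inv2.
pose C : set (set zlattice * set zlattice) := [set P | exists N' M',
  [/\ genus N N' /\ genus M M', representable_pair n N' M',
      f (k1 (proper_spinor_genus N')) = k2 (proper_spinor_genus M') &
      P = (isometry_class N', isometry_class M')]].
have CI N' M' s : SO_family (gram N) s -> moves N N' s ->
    moves M M' (family_conj S0 s) ->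
    f (k1 (proper_spinor_genus N')) = k2 (proper_spinor_genus M') ->
    [/\ genus N N', genus M M' & C (isometry_class N', isometry_class M')].
  move=> sO mN mM fk; have gN' := moves_genus sO mN.
  have gM' := moves_genus (SO_family_conj n0 uS0 S0_sim sO) mM.
  split=> //; exists N', M'; split=> //.
  apply: (representable_moves uS0 _ ind _ mN mM) => // p.
  exact: SO_family_unit sO.
exists C; split; last first.
  move=> N1 N2 M1 M2 gN1 gN2 gM1 gM2.
  (* Membership in [C] supplies possibly different representatives; isometric lattices in a genus
     share a spinor genus, hence a label. *)
  have CE N' M' : genus N N' -> genus M M' -> C (isometry_class N', isometry_class M') ->
      f (k1 (proper_spinor_genus N')) = k2 (proper_spinor_genus M').
    move=> gN' gM' [N3 [M3 [[gN3 gM3] _ fk [clN clM]]]].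
    rewrite (psg_isometry_class N_posdef gN' gN3 clN).
    by rewrite (psg_isometry_class M_posdef gM' gM3 clM).
  move=> /(CE _ _ gN1 gM1) f1 /(CE _ _ gN2 gM2) f2.
  split=> [/(psg_eqP (gram_sym N) N_posdef gN2.1 gN1.1) e|
           /(psg_eqP (gram_sym M) M_posdef gM2.1 gM1.1) e].
    apply/(psg_eqP (gram_sym M) M_posdef gM2.1 gM1.1); apply: k2_inj => //.
    by rewrite -f1 -f2 e.
  apply/(psg_eqP (gram_sym N) N_posdef gN2.1 gN1.1); apply: k1_inj => //.
  by apply: f_inj; rewrite f1 f2 e.
split.
- by move=> _ [N' [M' [[gN' gM'] _ _ ->]]]; split; [exists N'|exists M'].
- move=> N' M' [N1 [M1 [_ rep _ [clN clM]]]].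
  by apply: representable_isometric rep; apply: isometry_class_eq.
- move=> N' gN'; have [s [[sO [Ns mNs]] ks fks]] := f_meet (k1 (proper_spinor_genus N')).
  have [Ms mMs] := moves_conj_exists uS0 M mNs.
  rewrite /= (family_classE N_posdef sO mNs) in ks.
  rewrite /= (family_classE M_posdef (SO_family_conj n0 uS0 S0_sim sO) mMs) in fks.
  have NsN' : proper_spinor_genus Ns N'.
    apply/(psg_eqP (gram_sym N) N_posdef mNs.1 gN'.1).
    by apply: k1_inj => //; exact: moves_genus sO mNs.
  (* [N s] is only in the spinor genus of [N']; [t] takes it to [N'] itself, while its conjugate
     keeps [M s] in the matched spinor genus. *)
  have [t [tO mt tP]] := psg_conj n0 uS0 S0_sim mNs.1 NsN'.
  have [M' mM'] := moves_conj_exists uS0 Ms mt.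
  have mM := moves_trans mMs mM'; rewrite -(family_conjM _ _ uS0) in mM.
  have stO : SO_family (gram N) (fun p => s p *m t p).
    by move=> p; exact: special_orthogonalM (sO p) (tO p).
  have [||_ gM' CM'] := CI N' M' _ stO _ mM; first exact: moves_trans mNs mt.
    rewrite -fks; congr k2.
    apply/(psg_eqP (gram_sym M) M_posdef mMs.1); first by rewrite mM'.1 mMs.1.
    exact: tP mMs.1 mM'.
  by exists M'.
(* An injective self-map of a finite set is onto, so every spinor genus in gen(M) is matched; the
   correction [t] now starts on the side of [M] and returns through the inverse similitude. *)
move=> M' gM'; have [i fi] : exists i, f i = k2 (proper_spinor_genus M').
  by have [h fK hK] := injF_bij f_inj; exists (h (k2 (proper_spinor_genus M'))).
have [s [[sO [Ns mNs]] ks fks]] := f_meet i.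
have [Ms mMs] := moves_conj_exists uS0 M mNs.
have csO := SO_family_conj n0 uS0 S0_sim sO.
rewrite /= (family_classE N_posdef sO mNs) in ks.
rewrite /= (family_classE M_posdef csO mMs) fi in fks.
have MsM' : proper_spinor_genus Ms M'.
  apply/(psg_eqP (gram_sym M) M_posdef mMs.1 gM'.1).
  by apply: k2_inj => //; exact: moves_genus csO mMs.
have [t [tO mt tP]] := psg_conj n0V uS0V S0V_sim mMs.1 MsM'.
have [N' mN'] := moves_conj_exists uS0V Ns mt.
have ctO := SO_family_conj n0V uS0V S0V_sim tO.
have stO : SO_family (gram N) (fun p => s p *m family_conj (invmx S0) t p).
  by move=> p; exact: special_orthogonalM (sO p) (ctO p).
have mM : moves M M' (family_conj S0 (fun p => s p *m family_conj (invmx S0) t p)).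
  rewrite (family_conjM _ _ uS0) (family_conjK t uS0).
  exact: moves_trans mMs mt.
have [||gN' _ CN'] := CI N' M' _ stO _ mM; first exact: moves_trans mNs mN'.
  rewrite -fi -ks; congr (f (k1 _)); apply/esym.
  apply/(psg_eqP (gram_sym N) N_posdef mNs.1); first by rewrite mN'.1 mNs.1.
  exact: tP mNs.1 mN'.
by exists N'.
Qed.
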